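(* Let $p$ be a prime. There exists a function $f:\mathbb{N}\to\mathbb{R}$ such that for every finite solvable group $G$ with $\mathbf{O}_{p'}(G)=1$ there is a normal subgroup $N$ of $G$ with $\mathbf{F}(G)\subseteq N$, $N/\mathbf{F}(G)$ metabelian, and $|G/N|\le f(m)$, where $m$ is the number of conjugacy classes of $p$-elements of $G$.
   Context: $\mathbf{O}_{p'}(G)$ is the largest normal subgroup of $G$ of order coprime to $p$; $\mathbf{F}(G)$ is the Fitting subgroup; a $p$-element is an element whose order is a power of $p$ (including the identity). *)

(* Defs.v *)
From Stdlib Require Import Reals.
From mathcomp Require Import all_boot all_fingroup all_solvable.

Set Implicit Arguments. Unset Strict Implicit. Unset Printing Implicit Defensive.

Local Open Scope group_scope.

Definition p_elt_classes (gT : finGroupType) (p : nat) (G : {set gT}) :=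
  [set C in classes G | C \subset [set x : gT | p.-elt x]].

Definition metabelian (gT : finGroupType) (H : {set gT}) := abelian H^`(1).

(* Main.v *)
Require Import Defs.
From Stdlib Require Import Reals.
From Stdlib Require Import Classical.
From mathcomp Require Import all_boot all_fingroup all_solvable.
From mathcomp Require Import all_algebra all_field all_character.
From mathcomp Require Import zify.

(* Let P = O_p(G) = F(G). Since G is solvable, C_G(P) <= P, so a p'-element of G acting trivially
   on P / Phi(P) is 1, and G has at most m orbits on P / Phi(P), where m is the number of classes
   of p-elements. It therefore suffices to show that if a solvable group G has at most m orbits on
   a finite F_p-module V, then some subgroup M of index bounded in m is such that M'' acts on V as
   a p-group; this property passes to extensions and to finite intersections of subgroups, which
   allows induction on m.
   - If W is a proper nonzero submodule, W and V / W have fewer orbits than V.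
   - Otherwise take V faithful. For an abelian normal subgroup U let K be the span of U in End(V).
     U is a p'-group, so k ^ q = k on K for some power q of p, and k ^ (q - 1) is idempotent. If K
     has a nontrivial idempotent, its primitive idempotents e_1, ..., e_k are permuted by G and
     V is the direct sum of the V e_i. Counting nonzero components shows that k <= m, and the
     stabilizer of a summand has fewer orbits on it than G has on V.
   - Otherwise every such K is a field. Take U maximal; it is cyclic, and G acts on it by powers
     of the Frobenius map, so G / A is cyclic, where A = C_G(U). Take F maximal among the normal
     subgroups of G in A containing U with F' <= U; then C_A(F) = U, and representatives of the
     cosets of U in F are linearly independent over K. With N = |F : U|, this makes |V| at least
     about (|U| + 1) ^ sqrt(N), whereas |V| <= m |G| <= m |U| ^ 2 |A : U| and |A : U| <= (N ^ 2) ^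
     log_2(N). Hence |A : U| is bounded, and M = C_G(A / U) works: M / U has a central subgroup
     with cyclic quotient, so it is abelian. *)

Set Implicit Arguments. Unset Strict Implicit. Unset Printing Implicit Defensive.
Import GRing.Theory.
Local Open Scope group_scope.

(** * Indices of subgroups *)

Section Index.
Variable gT : finGroupType.
Implicit Types G H K M : {group gT}.

Lemma leq_index_capI G H K : #|G : H :&: K| <= #|G : H| * #|G : K|.
Proof.
have le1 (A B : {group gT}) : #|G : A :&: B| = #|G : G :&: A :&: B|.
  by rewrite -(indexgI G (A :&: B)) setIA.
rewrite le1 -(indexgI G H) -(indexgI G K).
have <- : G :&: H :&: (G :&: K) = G :&: H :&: K by rewrite setIACA setIid setIA.
rewrite -(Lagrange_index (subsetIl G H) (subsetIl (G :&: H) (G :&: K))).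
rewrite leq_mul2l; apply/orP; right.
rewrite (indexgI (G :&: H) (G :&: K)).
by rewrite subset_leq_card // imsetS // subsetIl.
Qed.

Lemma leq_index_bigcap (I : finType) (P : {set I}) (H : I -> {group gT}) G b :
  (forall i, i \in P -> #|G : H i| <= b) ->
  #|G : \bigcap_(i in P) H i| <= b ^ #|P|.
Proof.
have [n] := ubnP #|P|; elim: n P => // n IHn P lePn leb.
have [-> | [i Pi]] := set_0Vmem P.
  by rewrite big_set0 cards0 -indexgI setIT indexgg.
rewrite (big_setD1 i Pi) (cardsD1 i P) Pi /=.
apply: leq_trans (leq_index_capI _ _ _) _ => /=.
rewrite expnS leq_mul ?leb // IHn // => [|j /setD1P[_ /leb] //].
by rewrite (cardsD1 i P) Pi in lePn.
Qed.

Lemma leq_index_cent G (X : {set gT}) b :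
  (forall x, x \in X -> #|x ^: G| <= b) -> #|G : 'C_G(X)| <= b ^ #|X|.
Proof.
move=> leb; rewrite indexgI.
by apply: leq_index_bigcap => x Xx; rewrite -indexgI index_cent1 leb.
Qed.

(** The core is the intersection of the conjugates of [M], one for each coset of [M] in [G], and
    each conjugate has index [#|G : M|]. *)
Lemma leq_index_gcore G M : #|G : gcore M G| <= #|G : M| ^ #|G : M|.
Proof.
have sub: \bigcap_(C in rcosets M G) M :^ repr C \subset gcore M G.
  apply/bigcapsP=> x Gx; apply: (bigcap_min (M :* x)); first by apply/rcosetsP; exists x.
  have [m Mm ->] := rcosetP (mem_repr_rcoset M x).
  by rewrite conjsgM (conjGid Mm).
apply: leq_trans (_ : #|G : \bigcap_(C in rcosets M G) (M :^ repr C)%G| <= _).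
  apply: dvdn_leq; first exact: indexg_gt0.
  exact: (@indexgS _ G (\bigcap_(C in rcosets M G) (M :^ repr C)%G)%G (gcore M G)%G sub).
apply: leq_index_bigcap => C /rcosetsP[x Gx ->] /=.
have [m Mm ->] := rcosetP (mem_repr_rcoset M x).
by rewrite conjsgM (conjGid Mm) -{1}(conjGid Gx) indexJg.
Qed.

(** Adjoining an element outside the current subgroup at least doubles it, so log_2 of the index
    bounds the number of steps. *)
Lemma index_gen_exists G H : H \subset G ->
  exists2 X : {set gT}, G :=: H <*> X & 2 ^ #|X| <= #|G : H|.
Proof.
have [n] := ubnP #|G : H|; elim: n H => // n IHn H leGn sHG.
have [sGH | /subsetPn[x Gx notHx]] := boolP (G \subset H).
  exists set0; last by rewrite cards0 indexg_gt0.
  by apply/eqP; rewrite joingE setU0 genGid eqEsubset sGH.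
have sKG: (H <*> [set x])%G \subset G by rewrite join_subG sHG sub1set.
have sHK: H \subset (H <*> [set x])%G by rewrite joing_subl.
have K_gt1: 1 < #|(H <*> [set x])%G : H|.
  rewrite indexg_gt1; apply: contra notHx => /subset_trans/(_ (subxx _)) sKH.
  by apply: (subsetP sKH); rewrite mem_gen // !inE eqxx orbT.
have defGH := Lagrange_index sKG sHK.
have GK_gt0: 0 < #|G : (H <*> [set x])%G| by rewrite indexg_gt0.
case: (IHn _ _ sKG) => [|X defG leX].
  by rewrite -ltnS (leq_trans _ leGn) // -defGH ltnS -[X in X < _]muln1 ltn_pmul2l.
exists (x |: X).
  by rewrite defG /= -joingA [[set x] <*> X]joingE joing_idr.
apply: (@leq_trans (2 ^ #|X|.+1)); first by rewrite leq_exp2l // cardsU1 -add1n leq_add2r; case: (_ \in _).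
by rewrite -defGH expnS mulnC leq_mul.
Qed.

Lemma card_cyclic_Ldiv G n : cyclic G -> 0 < n -> #|[set x in G | x ^+ n == 1]| <= n.
Proof.
move=> cycG n_gt0.
have gS: group_set [set x in G | x ^+ n == 1].
  apply/group_setP; split=> [|x y]; first by rewrite !inE group1 expg1n eqxx.
  rewrite !inE => /andP[Gx /eqP xn] /andP[Gy /eqP yn].
  rewrite groupM //= expgMn ?xn ?yn ?mulg1 ?eqxx //.
  by apply: (centsP (cyclic_abelian cycG)).
have /cyclicP[y Dy]: cyclic (Group gS).
  by apply: cyclicS cycG; apply/subsetP=> x; rewrite inE => /andP[].
have: y \in Group gS by rewrite Dy cycle_id.
rewrite inE => /andP[_ yn]; have ->: #|[set x in G | x ^+ n == 1]| = #[y] by rewrite orderE -Dy.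
by rewrite dvdn_leq // order_dvdn.
Qed.
End Index.

(** * Orbits of a representation and block decompositions *)

Lemma leq_card_imset_factor (T U W : finType) (A : {set T}) (f : T -> U) (g : T -> W) :
  {in A &, forall x y, g x = g y -> f x = f y} -> #|f @: A| <= #|g @: A|.
Proof.
move=> fact; have [-> | [x0 Ax0]] := set_0Vmem A; first by rewrite !imset0 !cards0.
pose h c := f (odflt x0 [pick x in A | g x == c]).
suffices ->: f @: A = h @: (g @: A) by apply: leq_imset_card.
rewrite -imset_comp; apply: eq_in_imset => x Ax /=; rewrite /h.
case: pickP => [y /andP[Ay /eqP gy]|/(_ x)]; last by rewrite Ax eqxx.
by apply: fact; rewrite ?gy.
Qed.

Section Orbits.
Variable F : finFieldType.

Definition norb (gT : finGroupType) (G : {group gT}) n (rG : mx_representation F G n) :=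
  #|orbit ('MR rG) G @: [set: 'rV[F]_n]|.

Section OneRepr.
Variables (gT : finGroupType) (G : {group gT}) (n : nat) (rG : mx_representation F G n).

Lemma orbit_reprP (u v : 'rV[F]_n) :
  reflect (exists2 x, x \in G & v = (u *m rG x)%R)
          (orbit ('MR rG) G u == orbit ('MR rG) G v).
Proof.
rewrite eq_sym; have -> : (orbit ('MR rG) G v == orbit ('MR rG) G u) = (v \in orbit ('MR rG) G u).
  by apply/eqP/idP=> /(orbit_in_eqP _)->.
apply: (iffP orbitP) => [[x Gx <-] | [x Gx ->]]; exists x => //=.
  by rewrite mx_repr_actE.
by rewrite mx_repr_actE.
Qed.

Lemma leq_norb (T : finType) (f : T -> 'rV[F]_n) :
  (forall x y g, g \in G -> f y = (f x *m rG g)%R -> x = y) -> #|T| <= norb rG.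
Proof.
move=> inj_f; rewrite -cardsT.
have inj: injective (orbit ('MR rG) G \o f).
  by move=> x y /eqP/orbit_reprP[g Gg /inj_f]; apply.
rewrite -(card_imset _ inj) subset_leq_card //.
by apply/subsetP=> _ /imsetP[x _ ->]; apply: imset_f.
Qed.

Lemma leq_card_norb : #|{: 'rV[F]_n}| <= norb rG * #|G|.
Proof.
rewrite -cardsT.
have actsG: [acts G, on [set: 'rV[F]_n] | 'MR rG].
  by apply/subsetP=> x Gx; rewrite !inE Gx; apply/subsetP=> v; rewrite !inE.
rewrite (card_partition (orbit_partition actsG)) -sum_nat_const.
apply: leq_sum => _ /imsetP[v _ ->]; exact: leq_imset_card.
Qed.
End OneRepr.

Section TwoRepr.
Variables (gT hT : finGroupType) (G : {group gT}) (H : {group hT}) (n k : nat).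
Variables (rG : mx_representation F G n) (rH : mx_representation F H k).
Variable phi : 'rV[F]_k -> 'rV[F]_n.
Hypothesis fusion : forall x y g, g \in G -> phi y = (phi x *m rG g)%R ->
  exists2 h, h \in H & y = (x *m rH h)%R.

(** By [fusion] the orbit of [phi x] determines the orbit of [x]. The converse may fail, so [phi]
    can be a section of a quotient map as well as an inclusion. *)
Lemma norb_factor : norb rH <= #|(orbit ('MR rG) G \o phi) @: setT|.
Proof.
apply: leq_card_imset_factor => x y _ _ /eqP/orbit_reprP[g Gg /fusion[//|h Hh Dy]].
by apply/eqP/orbit_reprP; exists h.
Qed.

Lemma norb_leq : norb rH <= norb rG.
Proof.
apply: leq_trans norb_factor _; rewrite imset_comp.
by apply/subset_leq_card/imsetS/subsetT.
Qed.

Lemma norb_ltn v0 : (forall x g, g \in G -> v0 <> (phi x *m rG g)%R) -> norb rH < norb rG.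
Proof.
move=> v0phi; apply: leq_ltn_trans norb_factor _.
apply: proper_card; rewrite properE; apply/andP; split.
  by rewrite imset_comp; apply/imsetS/subsetT.
apply/subsetPn; exists (orbit ('MR rG) G v0); first exact: imset_f.
apply/imsetP=> [[x _ /= /esym/eqP/orbit_reprP[g Gg Dv0]]].
exact: v0phi Gg Dv0.
Qed.
End TwoRepr.
End Orbits.

Lemma leq_index_imset (gT : finGroupType) (G H : {group gT}) (T : finType) (f : gT -> T) :
  {in G &, forall x y, f x = f y -> x * y^-1 \in H} -> #|G : H| <= #|f @: G|.
Proof.
move=> fH; rewrite /indexg.
have ->: rcosets H G = (fun x => H :* x) @: G.
  by apply/setP=> C; apply/rcosetsP/imsetP.
apply: leq_card_imset_factor => x y Gx Gy /(fH x y Gx Gy) Hxy.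
by apply/rcoset_eqP; rewrite mem_rcoset.
Qed.

(* The last clause says that [M^`(2)] acts as a [p]-group; unlike triviality of the action, this
   passes to extensions of modules. *)
Definition metab_index (p c : nat) (F : fieldType) (gT : finGroupType) (G : {group gT}) n
    (rG : mx_representation F G n) :=
  exists M : {group gT}, [/\ M \subset G, #|G : M| <= c &
    forall x, x \in M^`(2) -> p^'.-elt x -> rG x = (1%:M)%R].

(** * Decompositions into summands permuted by the group *)

Section Blocks.
Variables (F : finFieldType) (gT : finGroupType) (G : {group gT}) (n' : nat).
Local Notation n := n'.+1.
Variables (rG : mx_representation F G n) (I : {set 'M[F]_n}).
Implicit Types (e f : 'M[F]_n) (v : 'rV[F]_n).
Hypothesis idI : {in I, forall e, (e * e = e)%R /\ e != 0%R}.
Hypothesis orthI : {in I &, forall e f, e != f -> (e * f = 0)%R}.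
Hypothesis sumI : (\sum_(e in I) e = 1)%R.
Hypothesis conjI : forall g e, g \in G -> e \in I -> (rG (g^-1)%g * e * rG g)%R \in I.

Let gK g : g \in G -> (rG g *m rG (g^-1)%g = 1%:M)%R.
Proof. by move=> Gg; rewrite -repr_mxM ?groupV // mulgV repr_mx1. Qed.

Let Kg g : g \in G -> (rG (g^-1)%g *m rG g = 1%:M)%R.
Proof. by move=> Gg; rewrite -repr_mxM ?groupV // mulVg repr_mx1. Qed.

Let fixIP e v : e \in I -> reflect (v *m e = v)%R (v <= e)%MS.
Proof.
move=> Ie; have [ee _] := idI Ie.
apply: (iffP submxP) => [[w ->]|<-]; last by exists v.
by rewrite -mulmxA -[(e *m e)%R]/(e * e)%R ee.
Qed.

Let orth e f v : e \in I -> f \in I -> (v *m e = v)%R -> e != f -> (v *m f = 0)%R.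
Proof.
by move=> Ie If <- ne; rewrite -mulmxA -[(e *m f)%R]/(e * f)%R orthI // mulmx0.
Qed.

Let conj_id g e v : g \in G -> (v *m e = v -> v *m rG g *m (rG (g^-1)%g * e * rG g) = v *m rG g)%R.
Proof.
move=> Gg ve; rewrite -[(_ * _ * _)%R]/(rG (g^-1)%g *m e *m rG g)%R !mulmxA.
by rewrite -(mulmxA v) gK // mulmx1 ve.
Qed.

(** The number of nonzero components of [v]; it is constant on orbits because [G] permutes the
    summands. *)
Let wt v := #|[set e in I | v *m e != 0]|%R.

Let wt_le g v : g \in G -> wt (v *m rG g)%R <= wt v.
Proof.
move=> Gg; pose c e := (rG g *m e *m rG (g^-1)%g)%R.
have inj_c: injective c.
  apply: can_inj (fun e => rG (g^-1)%g *m e *m rG g)%R _ => e.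
  by rewrite /c !mulmxA Kg // mul1mx -mulmxA Kg // mulmx1.
rewrite /wt -(card_imset _ inj_c) subset_leq_card //; apply/subsetP=> _ /imsetP[e + ->].
rewrite !inE => /andP[Ie nz]; apply/andP; split.
  by rewrite /c -{1}(invgK g); apply: conjI; rewrite ?groupV.
apply: contraNneq nz => /(congr1 (fun w => w *m rG g)%R)/eqP.
by rewrite mul0mx /c !mulmxA -(mulmxA (v *m rG g *m e)%R) Kg // mulmx1.
Qed.

Let wtJ g v : g \in G -> wt (v *m rG g)%R = wt v.
Proof.
move=> Gg; apply/eqP; rewrite eqn_leq wt_le //=.
have {1}->: v = (v *m rG g *m rG (g^-1)%g)%R by rewrite -mulmxA gK // mulmx1.
by apply: wt_le; rewrite groupV.
Qed.

Let nzr e : e \in I -> (nz_row e *m e = nz_row e)%R.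
Proof. by move=> Ie; apply/fixIP; rewrite ?nz_row_sub. Qed.

Let nzr_orth e f : e \in I -> f \in I -> (nz_row e *m f = if e == f then nz_row e else 0)%R.
Proof.
by move=> Ie If; case: eqVneq => [<-|]; [apply: nzr | apply: orth; rewrite ?nzr].
Qed.

(** Adding one nonzero vector from each of the first [k + 1] summands gives weight [k + 1], so these
    sums lie in distinct orbits. *)
Lemma card_blocks : #|I| <= norb rG.
Proof.
pose v (k : 'I_#|I|) := (\sum_(i < #|I| | (i <= k)%N) nz_row (enum_val i))%R.
have Iv (i : 'I_#|I|) : enum_val i \in I by apply: enum_valP.
have wv k : wt (v k) = k.+1.
  rewrite /wt; have ->: [set e in I | v k *m e != 0]%R = [set enum_val i | i : 'I_#|I| & i <= k].
    apply/setP=> e; rewrite inE; apply/andP/imsetP => [[Ie nz]|[i + ->]].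
      exists (enum_rank_in Ie e); last by rewrite enum_rankK_in.
      rewrite inE; apply: contraR nz => ltk; rewrite mulmx_suml big1 // => i lei.
      rewrite nzr_orth //; case: eqP => // De.
      case/negP: ltk; rewrite -(_ : i = enum_rank_in Ie e) //.
      by apply: enum_val_inj; rewrite enum_rankK_in.
    rewrite inE => lei; split=> //; rewrite mulmx_suml (bigD1 i) //= nzr_orth // eqxx.
    rewrite big1 ?addr0 => [|j /andP[_ ne_ji]]; first by rewrite nz_row_eq0; case: (idI (Iv i)).
    by rewrite nzr_orth // (inj_eq enum_val_inj) (negPf ne_ji).
  rewrite (card_imset _ enum_val_inj) -[RHS]card_ord.
  have lek: k.+1 <= #|I| by [].
  have inj_w: injective (widen_ord lek) by move=> a b /(congr1 val)/= ab; apply: val_inj.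
  rewrite -(card_imset _ inj_w) /=; congr #|pred_of_set _|.
  apply/setP=> i; rewrite !inE; apply/idP/imsetP => [lei | [j _ ->]]; last by rewrite /= -ltnS.
  by exists (Ordinal (lei : i < k.+1)) => //; apply: val_inj.
suffices: #|{: 'I_#|I|}| <= norb rG by rewrite card_ord.
apply: (@leq_norb _ _ _ _ rG _ v) => i j g Gg /(congr1 wt).
by rewrite wtJ // !wv => [[]] /val_inj.
Qed.

Hypothesis I_gt1 : 1 < #|I|.

Section Block.
Variable e : 'M[F]_n.
Hypothesis Ie : e \in I.
Let St := [group of rcent rG e].
Let sStG : St \subset G := rcent_sub rG e.

Lemma block_module : mxmodule (subg_repr rG sStG) e.
Proof.
apply/mxmoduleP=> x; rewrite inE => /andP[Gx /eqP cex] /=.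
by rewrite cex submxMl.
Qed.

(** An element of [G] carrying a nonzero vector of the summand into the summand stabilizes it, so
    distinct orbits of [St] stay distinct under [G]. The orbit of a vector with two nonzero
    components is missed. *)
Lemma block_norb : norb (submod_repr block_module) < norb rG.
Proof.
have vsub (x : 'rV_(\rank e)) : (val_submod x *m e = val_submod x)%R.
  by apply/fixIP; rewrite ?val_submodP.
have [e1 [e2 [Ie1 Ie2 ne12]]] := card_gt1P I_gt1.
apply: (@norb_ltn _ _ _ _ _ _ _ rG _ (@val_submod _ _ e 1) _ (nz_row e1 + nz_row e2)%R).
  move=> x y g Gg Dy; have := conj_id Gg (vsub x); rewrite -Dy.
  set f := (_ * _ * _)%R => yf; have If: f \in I by apply: conjI.
  have [Df | ne_fe] := eqVneq f e.
    have Sg: g \in St.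
      rewrite inE Gg; apply/eqP; rewrite -[in RHS]Df /f.
      by rewrite -[(_ * _ * _)%R]/(rG (g^-1)%g *m e *m rG g)%R !mulmxA gK // mul1mx.

    exists g => //; apply: val_submod_inj.
    by rewrite (val_submodJ block_module).
  have y0: val_submod y = 0%R by rewrite -(vsub y) (orth If Ie yf).
  have x0: val_submod x = 0%R.
    by rewrite -[val_submod x]mulmx1 -(gK Gg) mulmxA -Dy y0 mul0mx.
  exists 1; rewrite ?group1 //.
  by move/eqP: y0; move/eqP: x0; rewrite !val_submod_eq0 => /eqP-> /eqP->; rewrite mul0mx.
move=> x g Gg Dv; have := conj_id Gg (vsub x); rewrite -Dv.
set f := (_ * _ * _)%R => vf; have If: f \in I by apply: conjI.
have nz e' : e' \in I -> nz_row e' <> 0%R.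
  by move=> Ie'; apply/eqP; rewrite nz_row_eq0; case: (idI Ie').
have [Df | ne_f] := eqVneq f e1.
  apply: (nz e2 Ie2); have := orth If Ie2 vf; rewrite Df mulmxDl !nzr_orth // eqxx.
  by rewrite (negPf ne12) add0r; apply.
apply: (nz e1 Ie1); have := orth If Ie1 vf ne_f; rewrite mulmxDl !nzr_orth // eqxx.
by rewrite [e2 == _]eq_sym (negPf ne12) addr0.
Qed.

Lemma block_index : #|G : St| <= #|I|.
Proof.
apply: leq_trans (leq_index_imset (f := fun g => rG (g^-1)%g * e * rG g)%R _) _.
  move=> x y Gx Gy Dxy; rewrite inE groupM ?groupV //= !repr_mxM ?groupV //.
  apply/eqP; move/(congr1 (fun A => rG x *m A *m rG (y^-1)%g)%R): Dxy.
  rewrite -![(_ * _ * _)%R]/(_ *m _ *m _)%R !mulmxA gK // mul1mx => ->.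
  by rewrite -!mulmxA gK // mulmx1.
by rewrite subset_leq_card //; apply/subsetP=> _ /imsetP[g Gg ->]; apply: conjI.
Qed.
End Block.

(** Intersect the subgroups found for the at most [m] summands: by [sumI], an element acting
    trivially on every summand acts trivially. The factor [m * c] is the index of a stabilizer times
    an index inside it. *)
Lemma metab_index_blocks p c m : norb rG <= m ->
  (forall e (Ie : e \in I), metab_index p c (submod_repr (block_module e))) ->
  metab_index p ((m * c) ^ m) rG.
Proof.
move=> norbG IH; have leIm: #|I| <= m := leq_trans card_blocks norbG.
have [|M IM] := @fin_all_exists _ (fun=> {group gT}) (fun e M => e \in I ->
  [/\ M \subset G, #|G : M| <= m * c &
      forall x, x \in M^`(2) -> p^'.-elt x -> (e *m rG x = e)%R]).
  move=> e; have [Ie | _] := boolP (e \in I); last by exists 1%G.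
  have [M [sMS leM cM]] := IH e Ie; exists M => _.
  have sSG := rcent_sub rG e.
  split; first exact: subset_trans sMS sSG.
    by rewrite -(Lagrange_index sSG sMS) leq_mul // (leq_trans (block_index Ie)).
  move=> x M2x p'x; have Sx: x \in rcent rG e.
    by rewrite (subsetP sMS) // (subsetP (der_sub 2 M)).
  have := val_submodJ (block_module e) (1%:M)%R Sx.
  rewrite [submod_mx _ x](cM x) // mulmx1 => Dv.
  have /submxP[D De] : (e <= val_submod (U := e) 1%:M)%MS by rewrite val_submod1.
  by rewrite {1}De -mulmxA -[(val_submod _ *m _)%R]Dv -De.
exists (G :&: \bigcap_(e in I) M e)%G; split; first exact: subsetIl.
  rewrite /= indexgI; apply: leq_trans (leq_index_bigcap (b := m * c) _) _.
    by move=> e Ie; case: (IM e Ie).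
  have [m0 | m_gt0] := posnP (m * c); last by rewrite leq_pexp2l.
  have [e Ie] : exists e, e \in I by apply/card_gt0P; apply: ltnW.
  by have [_] := IM e Ie; rewrite m0 leqNgt indexg_gt0.
move=> x M2x p'x; rewrite -[rG x]mul1mx -[(1%:M)%R]sumI mulmx_suml.
apply: eq_bigr => e Ie; have [_ _ cM] := IM e Ie; apply: cM => //.
apply: subsetP M2x; apply: dergS; apply: subset_trans (subsetIr _ _) _.
exact: (bigcap_inf e).
Qed.
End Blocks.

(** * The enveloping algebra of an abelian normal subgroup *)

Section AbelianEnvelope.
Variables (p : nat) (gT : finGroupType) (G U : {group gT}) (n' : nat).
Local Notation n := n'.+1.
Variable rG : mx_representation 'F_p G n.
Hypotheses (p_pr : prime p) (irrG : mx_irreducible rG) (ffulG : mx_faithful rG).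
Hypotheses (nsUG : U <| G) (cUU : abelian U).

Implicit Types A B : 'M['F_p]_n.
Let sUG : U \subset G := normal_sub nsUG.
Local Notation E := (enveloping_algebra_mx (subg_repr rG sUG)).

Definition Uenv : {set 'M['F_p]_n} := [set A | (A \in E)%MS].

Lemma UenvP (A : 'M['F_p]_n) : reflect (exists a, A = \sum_(x in U) a x *: rG x)%R (A \in Uenv).
Proof. rewrite in_set. apply: (@envelop_mxP _ _ _ _ (subg_repr rG sUG)). Qed.

Lemma Uenv_id x : x \in U -> rG x \in Uenv.
Proof. by move=> Ux; rewrite inE (envelop_mx_id (subg_repr rG sUG)). Qed.

Lemma Uenv0 : 0%R \in Uenv. Proof. by rewrite inE linear0 sub0mx. Qed.

Lemma Uenv1 : 1%R \in Uenv.
Proof. by have := Uenv_id (group1 U); rewrite repr_mx1. Qed.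

Lemma UenvD A B : A \in Uenv -> B \in Uenv -> (A + B)%R \in Uenv.
Proof. by rewrite !inE => EA EB; rewrite linearD addmx_sub. Qed.

Lemma UenvZ c A : A \in Uenv -> (c *: A)%R \in Uenv.
Proof. by rewrite !inE => EA; rewrite linearZ scalemx_sub. Qed.

Lemma UenvN A : A \in Uenv -> (- A)%R \in Uenv.
Proof. by move=> EA; rewrite -scaleN1r UenvZ. Qed.

Lemma UenvB A B : A \in Uenv -> B \in Uenv -> (A - B)%R \in Uenv.
Proof. by move=> EA EB; rewrite UenvD ?UenvN. Qed.

Lemma UenvM A B : A \in Uenv -> B \in Uenv -> (A * B)%R \in Uenv.
Proof. by rewrite !inE; apply: envelop_mxM. Qed.

Lemma UenvX A i : A \in Uenv -> (A ^+ i)%R \in Uenv.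
Proof.
by move=> EA; elim: i => [|i IHi]; rewrite ?expr0 ?Uenv1 // exprS UenvM.
Qed.

Lemma Uenv_sum I (r : seq I) (P : pred I) (f : I -> 'M['F_p]_n) :
  (forall i, P i -> f i \in Uenv) -> (\sum_(i <- r | P i) f i)%R \in Uenv.
Proof. by move=> Ef; elim/big_ind: _ => //; [apply: Uenv0 | apply: UenvD]. Qed.

Lemma Uenv_comm B A :
  (forall x, x \in U -> GRing.comm B (rG x)) -> A \in Uenv -> GRing.comm B A.
Proof.
move=> cBU /UenvP[a ->]; apply: commr_sum => x Ux.
by rewrite /GRing.comm -scalerAr -scalerAl cBU.
Qed.

Lemma UenvC A B : A \in Uenv -> B \in Uenv -> (A * B = B * A)%R.
Proof.
move=> EA EB; apply: Uenv_comm EB => x Ux; apply/commr_sym.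
apply: Uenv_comm EA => y Uy; rewrite /GRing.comm -!(repr_mxMr rG) ?(subsetP sUG) //.
by rewrite (centsP cUU).
Qed.

(** ['O_p(U)] is a normal [p]-subgroup of [G], hence trivial, the module being faithful and
    irreducible in characteristic [p]. *)
Lemma Uenv_p'group : p^'.-group U.
Proof.
have Up1: 'O_p(U) = 1.
  apply/trivgP; rewrite -(pcore_faithful_mx_irr_pchar (pchar_Fp p_pr) irrG ffulG).
  by apply: pcore_max; rewrite ?pcore_pgroup // (char_normal_trans (pcore_char _ _)).
have := nilpotent_pcore_Hall p (abelian_nil cUU); rewrite Up1 => hallU.
by rewrite /pgroup -partn_eq1 // -(card_Hall hallU) cards1.
Qed.

Lemma Frobenius_UenvD A B i : A \in Uenv -> B \in Uenv ->
  ((A + B) ^+ (p ^ i) = A ^+ (p ^ i) + B ^+ (p ^ i))%R.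
Proof.
move=> EA EB; have pcharM: (p \in [pchar 'M['F_p]_n])%R.
  exact: (rmorph_pchar (@scalar_mx 'F_p n) (pchar_Fp p_pr)).
elim: i => [|i IHi]; first by rewrite !expr1.
rewrite expnSr !exprM IHi.
apply: (pFrobenius_autD_comm pcharM); apply: UenvC; exact: UenvX.
Qed.

(** The [p ^ i]-th power map is additive on the commutative algebra K and fixes scalars of ['F_p];
    once it fixes [U], it fixes the span. *)
Lemma Frobenius_Uenv i A : (forall x, x \in U -> x ^+ (p ^ i) = x) ->
  A \in Uenv -> (A ^+ (p ^ i) = A)%R.
Proof.
move=> Ui /UenvP[a ->].
pose Q B := (B \in Uenv) && (B ^+ (p ^ i) == B)%R.
suffices /andP[_ /eqP]: Q (\sum_(x in U) a x *: rG x)%R by [].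
elim/big_ind: _ => [|B C /andP[EB /eqP Bi] /andP[EC /eqP Ci]|x Ux].
- by rewrite /Q Uenv0 expr0n expn_eq0 -leqn0 leqNgt prime_gt0 //= eqxx.
- by rewrite /Q UenvD //= Frobenius_UenvD // Bi Ci.
rewrite /Q UenvZ ?Uenv_id //= exprZn -(repr_mxX rG) ?(subsetP sUG) // Ui //.
suffices ->: (a x ^+ (p ^ i) = a x)%R by [].
elim: i {Ui Q} => [|i IHi]; rewrite ?expr1 // expnSr exprM IHi.
by have := expf_card (a x); rewrite card_Fp.
Qed.

(** By Euler's theorem [p ^ Uexp] is 1 modulo the order of [U], so this power map fixes K
    pointwise. *)
Definition Uexp := totient #|U|.

Lemma Frobenius_Uexp A : A \in Uenv -> (A ^+ (p ^ Uexp) = A)%R.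
Proof.
apply: Frobenius_Uenv => x Ux; have x1 := expg_cardG Ux.
have co: coprime p #|U| by rewrite prime_coprime // -p'natE //; apply: Uenv_p'group.
by rewrite -(expg_mod _ x1) Euler_exp_totient // expg_mod.
Qed.

Lemma Uenv_conj g A : g \in G -> A \in Uenv -> (rG (g^-1)%g * A * rG g)%R \in Uenv.
Proof.
move=> Gg /UenvP[a ->]; rewrite mulr_sumr mulr_suml; apply: Uenv_sum => x Ux.
have Gx := subsetP sUG x Ux.
rewrite -scalerAr -scalerAl UenvZ // -!(repr_mxMr rG) ?groupM ?groupV //.
by rewrite -mulgA -conjgE Uenv_id // memJ_norm // (subsetP (normal_norm nsUG)).
Qed.

(** Being a field is expressed by the absence of nontrivial idempotents, since its failure then
    supplies a decomposition; [Uenv_unit] recovers inverses. *)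
Definition Uenv_field := forall e : 'M['F_p]_n, e \in Uenv -> (e * e = e)%R -> e = 0%R \/ e = 1%R.

Lemma Uenv_unit A : Uenv_field -> A \in Uenv -> A != 0%R -> A \is a GRing.unit.
Proof.
move=> fieldU EA nzA; have:= Frobenius_Uexp EA.
have q_gt1: 1 < p ^ Uexp by rewrite -(expn0 p) ltn_exp2l ?prime_gt1 // totient_gt0 cardG_gt0.
(* With [q = p ^ Uexp - 2], the power [A ^+ q.+1] is idempotent; it is nonzero because [A] times it
   is [A]. *)
rewrite -(subnK q_gt1); set q := _ - 2 => Aq.
have Aq1 : (A * A ^+ q.+1 = A)%R by rewrite -exprS -[in RHS]Aq addn2.
have cAq : (A ^+ q.+1 * A = A)%R by rewrite -exprSr -[in RHS]Aq addn2.
case: (fieldU (A ^+ q.+1)%R); first exact: UenvX.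
- by rewrite {2}exprS mulrA cAq -exprS.
- by move=> A0; rewrite -Aq1 A0 mulr0 eqxx in nzA.
by move=> A1; rewrite -(@unitrX_pos _ A q.+1) ?A1 ?unitr1.
Qed.

Definition prim_idem : {set 'M['F_p]_n} :=
  [set e in Uenv | [&& (e * e == e)%R, e != 0%R &
    [forall f in Uenv, (f * f == f)%R ==> (e * f == e)%R || (e * f == 0)%R]]].

Lemma prim_idemP e :
  reflect [/\ e \in Uenv, (e * e = e)%R, e != 0%R &
            forall f, f \in Uenv -> (f * f = f)%R -> (e * f = e)%R \/ (e * f = 0)%R]
          (e \in prim_idem).
Proof.
rewrite [e \in prim_idem]inE.
apply: (iffP and4P) => [[Ee /eqP ee nze /forall_inP prim] | [Ee ee nze prim]].
  split=> // f Ef ff; have := prim f Ef; rewrite ff eqxx /=.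
  by case/orP=> /eqP; [left | right].
split=> //; first exact/eqP.
apply/forall_inP=> f Ef; apply/implyP=> /eqP/(prim f Ef).
by case=> ->; rewrite eqxx ?orbT.
Qed.

Lemma idem_mulC e f : e \in Uenv -> f \in Uenv -> (e * e = e)%R -> (f * f = f)%R ->
  (e * f * (e * f) = e * f)%R.
Proof.
by move=> Ee Ef ee ff; rewrite mulrA -(mulrA e f e) (UenvC Ef Ee) mulrA ee -mulrA ff.
Qed.

(** If [t] is not primitive, some [f] splits it, and [t * f] is a nonzero idempotent with strictly
    fewer idempotents [below] it. *)
Lemma prim_idem_exists t : t \in Uenv -> (t * t = t)%R -> t != 0%R ->
  exists2 e, e \in prim_idem & (e * t = e)%R.
Proof.
pose below (s : 'M['F_p]_n) := [set g in Uenv | (g * g == g)%R && (g * s == g)%R].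
have [N] := ubnP #|below t|; elim: N t => // N IHN t leN Et tt nzt.
have [Pt | notPt] := boolP (t \in prim_idem); first by exists t.
have [f [Ef ff ntf nztf]] : exists f, [/\ f \in Uenv, (f * f = f)%R, (t * f != t)%R & (t * f != 0)%R].
  move: notPt; rewrite inE Et tt eqxx nzt /= negb_forall_in => /existsP[f /andP[Ef]].
  by rewrite negb_imply negb_or => /and3P[/eqP ff]; exists f.
have Etf := UenvM Et Ef.
have [||//|e Pe etf] := IHN (t * f)%R _ Etf; last 1 first.
- by exists e => //; rewrite -[in LHS]etf -mulrA -(mulrA t) (UenvC Ef Et) (mulrA t) tt.
- rewrite -ltnS; apply: leq_trans leN; rewrite ltnS; apply: proper_card.
  apply/properP; split.
    apply/subsetP=> g; rewrite !inE => /and3P[-> -> /eqP gtf] /=.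
    by rewrite -[in X in X == _]gtf -mulrA -(mulrA t) (UenvC Ef Et) (mulrA t) tt gtf.
  exists t; first by rewrite inE Et tt eqxx.
  by rewrite inE Et tt eqxx /= mulrA tt.
exact: idem_mulC.
Qed.

Lemma prim_idem_orth : {in prim_idem &, forall e f, e != f -> (e * f = 0)%R}.
Proof.
move=> e f /prim_idemP[Ee ee nze pe] /prim_idemP[Ef ff nzf pf] ne_ef.
case: (pe f Ef ff) => // De; case: (pf e Ee ee) => [Df | <-]; last exact: UenvC.
by rewrite -De UenvC // Df eqxx in ne_ef.
Qed.

Lemma prim_idem_mul_sum e : e \in prim_idem -> (e * (\sum_(f in prim_idem) f) = e)%R.
Proof.
move=> Pe; have [_ ee _ _] := prim_idemP _ Pe.
rewrite mulr_sumr (bigD1 e) //= ee big1 ?addr0 // => f /andP[Pf ne_fe].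
by rewrite prim_idem_orth // eq_sym.
Qed.

(** The sum [s] is idempotent. Were [1 - s] nonzero, a primitive [e] would lie below it, and
    [e * s = e] would give [e = 0]. *)
Lemma prim_idem_sum : (\sum_(e in prim_idem) e = 1)%R.
Proof.
set s := (\sum_(e in _) e)%R.
have Es: s \in Uenv by apply: Uenv_sum => e /prim_idemP[].
have ss: (s * s = s)%R.
  by rewrite {1 3}/s mulr_suml; apply: eq_bigr => e; apply: prim_idem_mul_sum.
apply/eqP; rewrite eq_sym -subr_eq0; apply/idPn => nz1s.
have [||e Pe] := prim_idem_exists _ _ nz1s; first by rewrite UenvB ?Uenv1.
  by rewrite mulrBl mul1r mulrBr mulr1 ss subrr subr0.
rewrite mulrBr mulr1 prim_idem_mul_sum // subrr => e0.
by have [_ _] := prim_idemP _ Pe; rewrite -e0 eqxx.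
Qed.

Lemma prim_idem_conj g e : g \in G -> e \in prim_idem -> (rG (g^-1)%g * e * rG g)%R \in prim_idem.
Proof.
move=> Gg /prim_idemP[Ee ee nze pe].
have gK : (rG g * rG (g^-1)%g = 1)%R by rewrite -(repr_mxMr rG) ?groupV // mulgV repr_mx1.
have Kg : (rG (g^-1)%g * rG g = 1)%R by rewrite -(repr_mxMr rG) ?groupV // mulVg repr_mx1.
have conjM A B : (rG (g^-1)%g * A * rG g * (rG (g^-1)%g * B * rG g) = rG (g^-1)%g * (A * B) * rG g)%R.
  by rewrite !mulrA -(mulrA _ (rG g) (rG (g^-1)%g)) gK mulr1.
apply/prim_idemP; split; first exact: Uenv_conj.
- by rewrite conjM ee.
- apply: contraNneq nze => /(congr1 (fun A => rG g * A * rG (g^-1)%g)%R)/eqP.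
  by rewrite !mulrA gK mul1r -mulrA gK mulr1 mulr0 mul0r.
move=> f Ef ff; pose f1 := (rG g * f * rG (g^-1)%g)%R.
have Df: f = (rG (g^-1)%g * f1 * rG g)%R.
  by rewrite /f1 !mulrA Kg mul1r -mulrA Kg mulr1.
have Ef1: f1 \in Uenv by rewrite /f1 -{1}(invgK g) Uenv_conj ?groupV.
have ff1 : (f1 * f1 = f1)%R.
  by rewrite /f1 !mulrA -(mulrA _ (rG (g^-1)%g) (rG g)) Kg mulr1 -(mulrA _ f f) ff.
case: (pe f1 Ef1 ff1) => Df1; rewrite Df conjM Df1; [by left | right].
by rewrite mulr0 mul0r.
Qed.

(** A single primitive idempotent would equal 1 by [prim_idem_sum]; lying below [e], it would force
    [e = 1]. *)
Lemma card_prim_idem e : e \in Uenv -> (e * e = e)%R -> e != 0%R -> e != 1%R -> 1 < #|prim_idem|.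
Proof.
move=> Ee ee nze; apply: contraR; rewrite -leqNgt => /card_le1_eqP I1.
have [f Pf De] := prim_idem_exists Ee ee nze.
have f1: f = 1%R.
  rewrite -prim_idem_sum (big_pred1 f) // => h /=.
  by apply/idP/eqP=> [Ph | ->//]; apply: I1.
by rewrite -[e]mul1r -f1 De f1.
Qed.

Lemma Frobenius_sum I (r : seq I) (P : pred I) (f : I -> 'M['F_p]_n) k :
  (forall i, P i -> f i \in Uenv) ->
  ((\sum_(i <- r | P i) f i) ^+ (p ^ k) = \sum_(i <- r | P i) f i ^+ (p ^ k))%R.
Proof.
move=> Ef; pose Q B C := (B \in Uenv) && (B ^+ (p ^ k) == C)%R.
suffices /andP[_ /eqP]: Q (\sum_(i <- r | P i) f i)%R (\sum_(i <- r | P i) f i ^+ (p ^ k))%R by [].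
elim/big_ind2: _ => [|B B' C C' /andP[EB /eqP <-] /andP[EC /eqP <-]|i Pi].
- by rewrite /Q Uenv0 expr0n expn_eq0 -leqn0 leqNgt prime_gt0 //= eqxx.
- by rewrite /Q UenvD //= Frobenius_UenvD.
by rewrite /Q Ef //= eqxx.
Qed.

Lemma Fp_exp k (c : 'F_p) : (c ^+ (p ^ k) = c)%R.
Proof.
elim: k => [|k IHk]; rewrite ?expr1 // expnSr exprM IHk.
by have := expf_card c; rewrite card_Fp.
Qed.

Section Field.
Hypothesis fieldU : Uenv_field.

(** Over the noncommutative matrix ring, the degree bounds the number of roots only if these commute
    and have invertible differences; both hold inside the field K. *)
Lemma Uenv_uniq_roots rs : {subset rs <= Uenv} -> uniq rs -> uniq_roots rs.
Proof.
elim: rs => //= B rs IHrs sE /andP[rsB Urs].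
have EB: B \in Uenv by rewrite sE ?mem_head.
have sE' : {subset rs <= Uenv} by move=> C rsC; rewrite sE // inE rsC orbT.
rewrite IHrs // andbT; apply/allP=> C rsC; have EC := sE' C rsC; rewrite /diff_roots (UenvC EB EC) eqxx /=.
by rewrite Uenv_unit ?UenvB // subr_eq0; apply: contraNneq rsB => <-.
Qed.

Lemma card_Uenv_fixed k : 0 < k -> (forall x, x \in U -> x ^+ (p ^ k) = x) -> #|Uenv| <= p ^ k.
Proof.
move=> k_gt0 Uk; have pk_gt1: 1 < p ^ k by rewrite -(expn0 p) ltn_exp2l ?prime_gt1.
pose f : {poly 'M['F_p]_n} := ('X^(p ^ k) - 'X)%R.
have size_f: size f = (p ^ k)%N.+1.
  by rewrite size_polyDl size_polyXn // size_polyN size_polyX ltnS.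
have := @max_ring_poly_roots _ f (enum Uenv); rewrite size_f -cardE ltnS; apply.
- by rewrite -size_poly_eq0 size_f.
- apply/allP=> B; rewrite mem_enum => EB.
  by rewrite rootE !hornerE hornerXn Frobenius_Uenv ?subrr.
by apply: Uenv_uniq_roots (enum_uniq _) => B; rewrite mem_enum.
Qed.

(** The minimal polynomial of [rG u], of degree [d], has as roots the images of [u ^ g] and of the
    [u ^+ (p ^ i)] for [i < d]. The latter are [d] distinct roots, and the field K has room for no
    more. *)
Lemma Uenv_galois u g : U :=: <[u]> -> g \in G -> exists i, u ^ g = u ^+ (p ^ i).
Proof.
move=> defU Gg; have Uu: u \in U by rewrite defU cycle_id.
have Gu := subsetP sUG u Uu.
pose A := rG u; pose f := mxminpoly A; pose d := degree_mxminpoly A.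
have EA: A \in Uenv by apply: Uenv_id.
have lepE: p ^ d <= #|Uenv|.
  have <-: #|{: 'rV['F_p]_d}| = (p ^ d)%N by rewrite card_mx card_Fp // mul1n.
  rewrite -cardsT -(card_imset _ (@horner_rVpoly_inj _ _ A)) subset_leq_card //.
  apply/subsetP=> _ /imsetP[v _ ->] /=; rewrite /horner_mx /horner_morph horner_coef.
  apply: Uenv_sum => i _; rewrite coef_map /= -[(_ * _)%R]/(_ *m _)%R mul_scalar_mx.
  by rewrite UenvZ ?UenvX.
have hornerE x : x \in U -> (horner_mx (rG x) f = \sum_(i < size f) f`_i *: rG (x ^+ i)%g)%R.
  move=> Ux; rewrite /horner_mx /horner_morph (horner_coef_wide _ (size_poly _ _)).
  apply: eq_bigr => i _; rewrite coef_map /= -[(_ * _)%R]/(_ *m _)%R mul_scalar_mx.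
  by rewrite (repr_mxX rG) // (subsetP sUG).
have fA: (horner_mx (rG u) f = 0)%R by apply: mx_root_minpoly.
have rootX k : horner_mx (rG (u ^+ (p ^ k)%N)) f = 0%R.
  have := congr1 (fun B => B ^+ (p ^ k))%R fA.
  rewrite hornerE // hornerE ?groupX // Frobenius_sum => [|i _]; last first.
    by rewrite UenvZ ?Uenv_id ?groupX.
  rewrite expr0n expn_eq0 -leqn0 leqNgt prime_gt0 //= mulr0n => D0; rewrite -[RHS]D0.
  apply: eq_bigr => i _; rewrite exprZn Fp_exp -(repr_mxX rG) ?groupX //.
  by rewrite -!expgM mulnC.
have Uug: u ^ g \in U by rewrite memJ_norm // (subsetP (normal_norm nsUG)).
have rootJ: horner_mx (rG (u ^ g)) f = 0%R.
  have := congr1 (fun B => rG (g^-1)%g * B * rG g)%R fA.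
  rewrite mulr0 mul0r hornerE // hornerE // => D0; rewrite -[RHS]D0 mulr_sumr mulr_suml.
  apply: eq_bigr => i _; rewrite -scalerAr -scalerAl -!(repr_mxMr rG) ?groupM ?groupX ?groupV //.
  by rewrite -mulgA -conjgE conjXg.
pose us := [seq u ^+ (p ^ val i) | i : 'I_d].
have [/imageP[i _ Dug] | notus] := boolP (u ^ g \in us); first by exists i.
pose rs := [seq rG x | x <- u ^ g :: us].
have sU : {subset u ^ g :: us <= U}.
  by move=> x; rewrite inE => /predU1P[->//|/imageP[i _ ->]]; rewrite groupX.
have uniq_us: uniq us.
  rewrite map_inj_in_uniq ?enum_uniq // => i j _ _.
  wlog ltij: i j / i < j => [IH Dij|Dij].
    by case: (ltngtP i j) => [/IH->//|/IH-> //|]; apply: val_inj.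
  (* This cancels the exponent [p ^ i] from [Dij], leaving [u ^+ (p ^ (j - i)) = u]. Then K would
     have at most [p ^ (j - i)] elements, against [lepE]. *)
  have u_a: u ^+ (p ^ (Uexp * i)) = u.
    elim: {+}(nat_of_ord i) => [|k IHk]; rewrite ?muln0 ?expg1 // mulnS expnD expgM.
    suffices ->: u ^+ (p ^ Uexp) = u by [].
    apply: (mx_faithful_inj ffulG); rewrite ?groupX //.
    by rewrite (repr_mxX rG) // Frobenius_Uexp.
  have a_gt0: 0 < Uexp by rewrite totient_gt0 cardG_gt0.
  have leia: i <= Uexp * i by rewrite leq_pmull.
  have uji: u ^+ (p ^ (j - i)) = u.
    rewrite -{1}u_a -expgM -expnD -[LHS](_ : (u ^+ (p ^ j)) ^+ (p ^ (Uexp * i - i)) = _).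
      by rewrite -Dij -expgM -expnD subnKC.
    by rewrite -expgM -expnD; congr (_ ^+ (_ ^ _)); rewrite addnBA // addnBA ?(ltnW ltij) // addnC.
  have /card_Uenv_fixed: forall x, x \in U -> x ^+ (p ^ (j - i)) = x.
    by move=> _ /[!defU]/cycleP[k ->]; rewrite -expgM mulnC expgM uji.
  rewrite subn_gt0 ltij => /(_ isT) leE.
  have := leq_trans lepE leE; rewrite leq_exp2l ?prime_gt1 // leqNgt.
  by rewrite (leq_ltn_trans (leq_subr _ _)).
have uniq_rs: uniq rs.
  rewrite map_inj_in_uniq /= ?notus ?uniq_us // => x y /sU Ux /sU Uy.
  by apply: (mx_faithful_inj ffulG); apply: (subsetP sUG).
have := @max_ring_poly_roots _ (map_poly (@scalar_mx _ n) f) rs.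
have mon_f: map_poly (@scalar_mx 'F_p n) f \is monic by rewrite monic_map // mxminpoly_monic.
have size_f: size (map_poly (@scalar_mx 'F_p n) f) = d.+1.
  rewrite size_map_poly_id0 ?size_mxminpoly //.
  by rewrite (monicP (mxminpoly_monic A)) oner_eq0.
rewrite size_f size_map /= size_image card_ord ltnn => contra; suffices: false by []; apply: contra.
- by rewrite monic_neq0.
- apply/andP; split; first by rewrite rootE; apply/eqP/rootJ.
  by apply/allP=> _ /mapP[_ /imageP[i _ ->] ->]; rewrite rootE; apply/eqP/rootX.
by apply: Uenv_uniq_roots uniq_rs => _ /mapP[x /sU Ux ->]; apply: Uenv_id.
Qed.
End Field.
End AbelianEnvelope.

(** * Linear independence over the field K and the size of V *)

Section Independence.
Variables (p : nat) (gT : finGroupType) (G U : {group gT}) (n' : nat).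
Local Notation n := n'.+1.
Variable rG : mx_representation 'F_p G n.
Hypotheses (p_pr : prime p) (irrG : mx_irreducible rG) (ffulG : mx_faithful rG).
Hypotheses (nsUG : U <| G) (cUU : abelian U).
Hypothesis fieldU : Uenv_field rG nsUG.
Local Notation Uenv := (Uenv rG nsUG).
Implicit Types A B : 'M['F_p]_n.

Let sUG : U \subset G := normal_sub nsUG.

Lemma Uenv_inv A : A \in Uenv -> A != 0%R -> exists2 B, B \in Uenv & (A * B = 1)%R.
Proof.
move=> EA nzA; have uA := Uenv_unit p_pr irrG ffulG cUU fieldU EA nzA.
have := Frobenius_Uexp p_pr irrG ffulG cUU EA.
have q_gt1: 1 < p ^ Uexp U by rewrite -(expn0 p) ltn_exp2l ?prime_gt1 // totient_gt0 cardG_gt0.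
rewrite -(subnK q_gt1); set q := _ - 2 => Aq; exists (A ^+ q)%R; first exact: UenvX.
by apply: (mulrI uA); rewrite mulr1 -exprS -exprS -addn2.
Qed.

Lemma card_Uenv_gt : #|U| < #|Uenv|.
Proof.
have inj: {in U &, injective rG} by apply: sub_in2 (mx_faithful_inj ffulG); apply: subsetP.
rewrite -(card_in_imset inj); apply: proper_card; apply/properP; split.
  by apply/subsetP=> _ /imsetP[x Ux ->]; apply: Uenv_id.
exists 0%R; first exact: Uenv0.
apply/imsetP=> [[x Ux] /esym x0]; have := repr_mx_unitr rG (subsetP sUG x Ux).
by rewrite x0 unitr0.
Qed.

Lemma rG_inj_unit x y : x \in U -> y \in U -> x != y ->
  exists2 B, B \in Uenv & ((rG x - rG y) * B = 1)%R.
Proof.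
move=> Ux Uy ne; apply: Uenv_inv; first by rewrite UenvB ?Uenv_id.
by rewrite subr_eq0; apply: contraNneq ne => /(mx_faithful_inj ffulG)->; rewrite ?(subsetP sUG).
Qed.

(* Greedily chosen generators of the row space as a [U]-module: each new one multiplies the
   size of the span by at least [#|U|.+1], because [U] acts freely on the quotient. *)
Lemma Uenv_generators : exists vs : seq 'rV['F_p]_n,
  #|U|.+1 ^ size vs <= #|{: 'rV['F_p]_n}| /\
  (forall A, (forall x, x \in U -> GRing.comm A (rG x)) ->
     (forall v, v \in vs -> v *m A = 0)%R -> A = 0%R).
Proof.
pose rU := subg_repr rG sUG.
(* An endomorphism commuting with [U] that kills the chosen generators kills [W]. *)
pose det (vs : seq 'rV['F_p]_n) (W : 'M['F_p]_n) := forall A, (forall x, x \in U -> GRing.comm A (rG x)) ->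
     (forall v, v \in vs -> v *m A = 0)%R -> (W *m A = 0)%R.
suffices ext (W : 'M['F_p]_n) (vs : seq 'rV['F_p]_n) :
    mxmodule rU W -> #|U|.+1 ^ size vs <= #|rowg W| -> det vs W ->
    exists us : seq 'rV['F_p]_n, #|U|.+1 ^ size us <= #|{: 'rV['F_p]_n}| /\ det us 1%:M%R.
  have [||vs [le_vs dvs]] := ext 0%R [::] (mxmodule0 _ _).
  - by rewrite expn0 cardG_gt0.
  - by move=> A _ _; rewrite mul0mx.
  by exists vs; split=> // A cA vA; rewrite -[A]mul1mx dvs.
have [k] := ubnP (n - \rank W); elim: k W vs => // k IHk W vs leWk modW leW detW.
have [fullW | nfullW] := boolP (row_full W).
  exists vs; split; first by apply: leq_trans leW (max_card _).
  move=> A cA /(detW A cA) WA0; apply/eqP; rewrite -submx0.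
  by move: fullW; rewrite -sub1mx => /(submxMr A); rewrite mul1mx WA0.
have [v notWv]: exists v : 'rV['F_p]_n, ~~ (v <= W)%MS.
  have /row_subPn[i] : ~~ ((1%:M)%R <= W)%MS by rewrite sub1mx.
  by exists (row i 1%:M)%R.
pose W' : 'M['F_p]_n := (W + cyclic_mx rU v)%MS.
have Wv : (v <= W')%MS by rewrite (submx_trans (cyclic_mx_id rU v)) ?addsmxSr.
have modW' : mxmodule rU W' by rewrite addsmx_module ?cyclic_mx_module.
have ltWW' : \rank W < \rank W'.
  rewrite (ltn_leqif (mxrank_leqif_sup (addsmxSl W (cyclic_mx rU v)))).
  by apply: contra notWv; apply: submx_trans.
apply: (IHk W' (v :: vs)) => //.
- rewrite -ltnS; apply: leq_trans leWk; rewrite ltnS ltn_sub2l //.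
  by apply: leq_trans ltWW' (rank_leq_col _).
- pose f (a : gT * 'rV['F_p]_n) := (v *m rG a.1 + a.2)%R.
  have W_stab B w : B \in Uenv -> (w <= W)%MS -> ((w *m B)%R <= W)%MS.
    by rewrite inE => EB; apply: (mxmodule_envelop modW).
  have inj_f: {in setX U (rowg W) &, injective f}.
    move=> [x w] [y w']; rewrite !inE /= => /andP[Ux Ww] /andP[Uy Ww'] /eqP.
    rewrite /f /= -subr_eq0 opprD addrACA -mulmxBr addr_eq0 => /eqP Dxy.
    suffices xy: x = y.
      by move/eqP: Dxy; rewrite xy subrr mulmx0 eq_sym oppr_eq0 subr_eq0 => /eqP->.
    apply/eqP; apply: contraR notWv => /(rG_inj_unit Ux Uy)[B EB unitB].
    rewrite -[v]mulmx1 -[(1%:M)%R]unitB -[(_ * B)%R]/(_ *m B)%R mulmxA Dxy.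
    by rewrite W_stab // eqmx_opp addmx_sub // eqmx_opp.
  rewrite expnS mulSn; apply: leq_trans (_ : #|rowg W :|: f @: setX U (rowg W)| <= _).
    rewrite cardsU (_ : _ :&: _ = set0) ?cards0 ?subn0 ?(card_in_imset inj_f) ?cardsX.
      by rewrite leq_add // leq_mul.
    apply/setP=> z; rewrite !inE; apply/negP=> /andP[Wz /imsetP[[x w]]].
    rewrite !inE /= => /andP[Ux Ww] Dz; case/negP: notWv.
    have Dv: (v *m rG x = z - w)%R by rewrite Dz /f /= addrK.
    rewrite -(repr_mxK rG (subsetP sUG x Ux) v) Dv W_stab ?Uenv_id ?groupV //.
    by rewrite addmx_sub // eqmx_opp.
  rewrite subset_leq_card // subUset; apply/andP; split.
    by apply/subsetP=> w; rewrite !inE => Ww; rewrite (submx_trans Ww) ?addsmxSl.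
  apply/subsetP=> _ /imsetP[[x w] + ->]; rewrite !inE /= => /andP[Ux Ww].
  by rewrite addmx_sub ?(mxmodule_trans modW' Ux) // (submx_trans Ww) ?addsmxSl.
move=> A cA vA; apply/sub_kermxP; rewrite addsmx_sub; apply/andP; split.
  by apply/sub_kermxP; apply: detW => // w vs_w; rewrite vA // inE vs_w orbT.
apply: cyclic_mx_sub; last by apply/sub_kermxP; rewrite vA ?mem_head.
by apply: kermx_centg_module; apply/centgmxP=> x Ux; apply: cA.
Qed.

Variable F : {group gT}.
Hypotheses (sUF : U \subset F) (sFG : F \subset G) (cFU : U \subset 'C(F)).
Hypotheses (der1F : F^`(1) \subset U) (sZFU : 'C_F(F) \subset U).
Local Notation N := #|F : U|.

Definition coset_sum (k : {set gT} -> 'M['F_p]_n) : 'M['F_p]_n :=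
  (\sum_(C in rcosets U F) k C * rG (repr C))%R.

Lemma repr_rcosetsP C : C \in rcosets U F -> repr C \in F /\ C = U :* repr C.
Proof.
case/rcosetsP=> x Fx ->; have Uxr := mem_repr_rcoset U x.
split; last by rewrite (rcoset_eqP Uxr).
by have [u Uu ->] := rcosetP Uxr; rewrite groupM // (subsetP sUF).
Qed.

(* A shortest relation, compared with its conjugate by an element of [F] moving two of its
   terms differently, yields a shorter one. *)
Lemma coset_free (k : {set gT} -> 'M['F_p]_n) :
  (forall C, k C \in Uenv) -> coset_sum k = 0%R -> {in rcosets U F, forall C, k C = 0%R}.
Proof.
have [s] := ubnP #|[set C in rcosets U F | k C != 0%R]|; elim: s k => // s IHs k.
rewrite ltnS => les Ek k0 C0 FC0; apply/eqP/idPn=> nzC0.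
have [Fx0 DC0] := repr_rcosetsP FC0; set x0 := repr C0 in Fx0 DC0.
have [only0 | ] := boolP [forall C in rcosets U F, (C != C0) ==> (k C == 0%R)].
  move: k0; rewrite /coset_sum (bigD1 C0) //= big1 ?addr0 => [|C /andP[FC neC]]; last first.
    by have /implyP/(_ neC)/eqP-> := forall_inP only0 C FC; rewrite mul0r.
  move=> kx0; case/eqP: nzC0; apply: (mulIr (repr_mx_unitr rG (subsetP sFG _ Fx0))).
  by rewrite kx0 mul0r.
rewrite negb_forall_in => /existsP[C1 /andP[FC1]]; rewrite negb_imply => /andP[neC nzC1].
have [Fx1 DC1] := repr_rcosetsP FC1; set x1 := repr C1 in Fx1 DC1.
(* [x1 * x0^-1] is outside [U], hence outside ['C_F(F)], so some [f] separates the two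
   commutators. *)
have [f Ff ne_f]: exists2 f, f \in F & [~ x1, f] != [~ x0, f].
  apply/exists_inP; rewrite -negb_forall_in; apply: contra neC => /forall_inP eqf.
  rewrite DC1 DC0; apply/eqP/rcoset_eqP; rewrite mem_rcoset (subsetP sZFU) //.
  rewrite inE groupM ?groupV //=; apply/centP=> f /eqf/eqP eq_f.
  by apply/commgP/conjg_fixP; rewrite conjMg conjVg (conjg_mulR x1) (conjg_mulR x0) eq_f invMg -mulgA mulKVg.
have Ucomm x : x \in F -> [~ x, f] \in U.
  by move=> Fx; rewrite (subsetP der1F) // mem_commg.
have Gf := subsetP sFG f Ff.
(* Coefficients of the relation conjugated by [f], minus [rG [~ x0, f]] times the relation: the one
   at [C0] vanishes, the one at [C1] does not. [k1] extends them by 0 off the cosets. *)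
pose k' C := (k C * (rG [~ repr C, f] - rG [~ x0, f]))%R.
have Ek' C : C \in rcosets U F -> k' C \in Uenv.
  by case/repr_rcosetsP=> Fx _; rewrite UenvM ?UenvB ?Uenv_id ?Ucomm.
pose k1 C := if C \in rcosets U F then k' C else 0%R.
suffices: k1 C1 = 0%R.
  rewrite /k1 FC1 /k' -/x1 => k10; case/eqP: nzC1.
  have [B EB unitB] := rG_inj_unit (Ucomm x1 Fx1) (Ucomm x0 Fx0) ne_f.
  by rewrite -[k C1]mulr1 -unitB mulrA k10 mul0r.
apply: (IHs k1) FC1 => [|C|].
- apply: leq_trans les; apply: proper_card.
  apply/properP; split.
    apply/subsetP=> C; rewrite !inE /k1 => /andP[-> /=].
    by apply: contraNneq => kC0; rewrite /k' kC0 mul0r.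
  by exists C0; rewrite !inE FC0 //= /k1 FC0 /k' subrr mulr0 eqxx.
- by rewrite /k1; case: ifP => [/Ek'|_]; last exact: Uenv0.
- have kf C : GRing.comm (k C) (rG f).
    apply/commr_sym; apply: (Uenv_comm _ (Ek C)) => x Ux.
    have Gx := subsetP sUG x Ux; rewrite /GRing.comm -!(repr_mxMr rG) //.
    by rewrite (centP (subsetP cFU x Ux)).
  transitivity (rG (f^-1)%g * coset_sum k * rG f - rG [~ x0, f] * coset_sum k)%R; last first.
    by rewrite k0 !mulr0 mul0r subrr.
  rewrite /coset_sum !mulr_sumr mulr_suml -sumrB; apply: eq_bigr => C FC.
  have [Fx _] := repr_rcosetsP FC; set x := repr C in Fx *.
  have Gx := subsetP sFG x Fx; have Gxf := subsetP sUG _ (Ucomm x Fx).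
  rewrite /k1 FC /k' -/x mulrBr mulrBl; congr (_ - _)%R.
    rewrite -mulrA -(repr_mxMr rG) //.
    have ->: [~ x, f] * x = x ^ f.
      by rewrite conjg_mulR (centP (subsetP cFU _ (Ucomm x Fx))).
    have cf' : (k C * rG (f^-1)%g = rG (f^-1)%g * k C)%R.
      by have := commrV (kf C); rewrite -(repr_mxVr rG).
    by rewrite mulrA -cf' -!mulrA conjgE !(repr_mxMr rG) ?groupM ?groupV.
  rewrite !mulrA; congr (_ * _)%R; by apply: (UenvC cUU (Ek C)); apply: Uenv_id; apply: Ucomm Fx0.
Qed.

(** [d] is the number of generators from [Uenv_generators]. Combinations of coset representatives
    commute with [U], so their values on the generators determine them; with [coset_free], the
    N-tuples over K embed into the d-tuples over V. *)
Lemma leq_Uenv_dim : exists d : nat,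
  #|U|.+1 ^ d <= #|{: 'rV['F_p]_n}| /\ #|U|.+1 ^ N <= #|{: 'rV['F_p]_n}| ^ d.
Proof.
have [vs [le_vs det]] := Uenv_generators; exists (size vs); split=> //.
apply: leq_trans (_ : #|Uenv| ^ N <= _); first by rewrite leq_exp2r ?indexg_gt0 // card_Uenv_gt.
pose K := [set k : {ffun {set gT} -> 'M['F_p]_n} in pffun_on 0%R (mem (rcosets U F)) (mem Uenv)].
have <-: #|K| = (#|Uenv| ^ N)%N by rewrite cardsE card_pffun_on.
pose f (k : {ffun {set gT} -> 'M['F_p]_n}) :=
  [ffun i : 'I_(size vs) => vs`_i *m coset_sum k]%R.
have inj_f: {in K &, injective f}.
  move=> k1 k2; rewrite !inE => /pffun_onP[s1 r1] /pffun_onP[s2 r2] eq_f.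
  have E1 k : (forall y, y \in image k (mem (rcosets U F)) -> y \in Uenv) ->
     {in rcosets U F, forall C, k C \in Uenv}.
    by move=> rk C FC; apply/rk/imageP; exists C.
  pose k C := (if C \in rcosets U F then k1 C - k2 C else 0)%R.
  have Ek C : k C \in Uenv.
    by rewrite /k; case: ifP => [FC|_]; rewrite ?Uenv0 // UenvB ?(E1 _ r1) ?(E1 _ r2).
  have Dk : coset_sum k = (coset_sum k1 - coset_sum k2)%R.
    by rewrite -sumrB; apply: eq_bigr => C FC; rewrite /k FC mulrBl.
  have k0: coset_sum k = 0%R.
    apply: det => [x Ux|v].
      apply/commr_sym/commr_sum => C FC; have [Fx _] := repr_rcosetsP FC.
      apply: commrM; first by apply: Uenv_comm (Ek C) => y Uy; apply: (UenvC cUU (Uenv_id rG nsUG Ux) (Uenv_id rG nsUG Uy)).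
      rewrite /GRing.comm -!(repr_mxMr rG) ?(subsetP sUG x Ux) ?(subsetP sFG) //.
      by rewrite (centP (subsetP cFU x Ux)).
    case/(nthP 0%R)=> i lti <-; move/ffunP/(_ (Ordinal lti)): eq_f; rewrite !ffunE /=.
    by move=> eq_i; rewrite Dk mulmxBr eq_i subrr.
  apply/ffunP=> C; have [FC | notFC] := boolP (C \in rcosets U F).
    by apply/eqP; rewrite -subr_eq0; have := coset_free Ek k0 FC; rewrite /k FC => ->.
  have off (k' : {ffun {set gT} -> 'M['F_p]_n}) : (0%R).-support k' \subset mem (rcosets U F) -> k' C = 0%R.
    by move/subsetP/(_ C)/contra/(_ notFC); rewrite inE negbK => /eqP.
  by rewrite (off k1) // (off k2).
rewrite -(card_in_imset inj_f) (leq_trans (max_card _)) //.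
by rewrite card_ffun card_ord.
Qed.
End Independence.

(** * Primitive linear groups *)

Section Numeric.
Local Open Scope nat_scope.

(** At 22 the inequality fails; from 23 on, the fourth power at most doubles at each step. *)
Lemma exp2_gt_pow4 l : 23 <= l -> 18 * l ^ 4 < 2 ^ l.
Proof.
elim: l => // l IHl; rewrite leq_eqVlt => /predU1P[<-|ltl]; first by vm_compute.
have {}IHl := IHl ltl; apply: (@leq_ltn_trans (2 * (18 * l ^ 4))).
  rewrite mulnCA leq_mul2l /=; rewrite ltnS in ltl.
  rewrite !expnS expn0 !muln1; nia.
by rewrite [in X in _ < X]expnS ltn_pmul2l.
Qed.

(** Here [s] is [|U| + 1], [N] is [|F : U|], while [d] and [r] count generators of the module over K
    and of [F] over [U]. With [l] about log_2 of [N], a large [l] gives [V <= s ^ b] with [b]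
    quadratic in [l]; then [d <= b] and [N <= b * b] is quartic in [l], against [2 ^ l <= 2 * N]. *)
Lemma few_orbits_bound m N r s d V : 1 < s -> s ^ d <= V -> s ^ N <= V ^ d ->
  V <= m * (s * s * (N * N) ^ r) -> 2 ^ r <= N ->
  (N * N) ^ r <= 2 ^ (2 * (m + 25) ^ 2).
Proof.
move=> s_gt1 dV NV Vle rN.
have [l [Nl lN]]: exists l, N <= 2 ^ l /\ 2 ^ l <= 2 * N.
  have N_gt0: 0 < N by apply: leq_trans rN; rewrite expn_gt0.
  exists (trunc_log 2 N).+1; split; first by rewrite ltnW // trunc_log_ltn.
  by rewrite expnS leq_mul2l /= trunc_logP.
have le_rl: r <= l by rewrite -(@leq_exp2l 2) // (leq_trans rN).
have le_beta k : l <= k -> (N * N) ^ r <= 2 ^ (2 * k ^ 2).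
  move=> lek; apply: (@leq_trans ((2 ^ k * 2 ^ k) ^ k)).
    apply: leq_trans (_ : (N * N) ^ k <= _); last first.
      by have [->|k_gt0] := posnP k; rewrite // leq_exp2r // leq_mul // (leq_trans Nl) // leq_exp2l.
    have [N0 | NN_gt0] := posnP (N * N); last by rewrite leq_pexp2l // (leq_trans le_rl).
    by move: rN; rewrite (_ : N = 0) ?leqn0 ?expn_eq0 //; apply/eqP; rewrite -(orbb (N == 0)) -muln_eq0 N0.
  by rewrite -expnD addnn -mul2n -expnM -mulnA leq_exp2l.
(* The offset 25 ensures both [m + 2 <= l] and [23 <= l] in the remaining case. *)
apply: (le_beta (m + 25)); have [//|lt_l] := leqP l (m + 25).
have l_ge : m + 25 <= l by apply: ltnW.
(* The summands are exponents of [s] covering [m], [s * s] and [(N * N) ^ r]. *)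
pose b := m + 2 + 2 * l ^ 2.
have Vb: V <= s ^ b.
  apply: leq_trans Vle _; rewrite /b -addnA expnD expnD leq_mul //.
    by apply: leq_trans (ltnW (ltn_expl m (isT : 1 < 2))) _; have [->|m0] := posnP m; rewrite // leq_exp2r.
  rewrite leq_mul ?expnS ?expn0 ?muln1 //; apply: leq_trans (le_beta l (leqnn l)) _.
  have l_gt0 : 0 < l by apply: leq_trans l_ge; rewrite addnC.
  by rewrite leq_exp2r // muln_gt0 expn_gt0 l_gt0.
have db: d <= b by rewrite -(leq_exp2l _ _ s_gt1) (leq_trans dV).
have Nb : N <= b * b.
  rewrite -(leq_exp2l _ _ s_gt1) (leq_trans NV) //.
  have [->|d_gt0] := posnP d; first by rewrite expn0 expn_gt0 ltnW.
  apply: (@leq_trans ((s ^ b) ^ d)); first by rewrite leq_exp2r.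
  by rewrite -expnM leq_exp2l // leq_mul2l db orbT.
have b3 : b <= 3 * l ^ 2.
  rewrite (_ : 3 = 1 + 2) // mulnDl mul1n leq_add2r.
  apply: (@leq_trans l); first by apply: leq_trans l_ge; rewrite leq_add2l.
  by rewrite -{1}(expn1 l) leq_pexp2l // (leq_trans _ l_ge) // addnC.
have: 2 ^ l <= 18 * l ^ 4.
  apply: leq_trans lN _; rewrite (_ : 18 = 2 * 9) // -mulnA leq_mul2l /=.
  apply: leq_trans Nb _; apply: leq_trans (leq_mul b3 b3) _.
  by rewrite mulnACA -expnD.
by rewrite leqNgt exp2_gt_pow4 // (leq_trans _ l_ge) // (leq_trans _ (leq_addl _ _)).
Qed.
End Numeric.

(** * Self-centralizing subgroups of class at most two *)

Section CentralSeries.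
Variable gT : finGroupType.
Implicit Types G A U F : {group gT}.

(** Two solutions in one coset of the central subgroup [U] differ by an element of [U] with [N]-th
    power 1; cyclic [U] has at most [N] of those, and there are [N] cosets. *)
Lemma card_root_leq U F c : cyclic U -> U \subset F -> U \subset 'C(F) ->
  #|[set z in F | z ^+ #|F : U| == c]| <= #|F : U| * #|F : U|.
Proof.
move=> cycU sUF cUF; set N := #|F : U|; set S := [set z in F | _].
rewrite -sum1_card (partition_big (rcoset U) (mem (rcosets U F))) /=; last first.
  by move=> z; rewrite inE => /andP[Fz _]; rewrite rcosetE; apply/rcosetsP; exists z.
rewrite -sum_nat_const; apply: leq_sum => C _; rewrite sum1dep_card.
set SC := [set z | _]; have [-> | [z0 SCz0]] := set_0Vmem SC; first by rewrite cards0.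
apply: leq_trans (card_cyclic_Ldiv cycU (indexg_gt0 F U)); rewrite -/N.
have inj: injective (fun z => z * z0^-1) by apply: mulIg.
rewrite -(card_imset _ inj) subset_leq_card //; apply/subsetP=> _ /imsetP[z + ->].
move: SCz0; rewrite !inE => /andP[/andP[Fz0 /eqP z0c] /eqP Uz0] /andP[/andP[Fz /eqP zc] /eqP Uz].
have Uzz0: z * z0^-1 \in U by rewrite -mem_rcoset -rcosetE Uz0 -Uz rcosetE rcoset_refl.
rewrite Uzz0 /=; apply/eqP/(mulIg (z0 ^+ N)); rewrite mul1g [RHS]z0c -[RHS]zc.
rewrite -expgMn ?mulgKV //; apply: (centP (subsetP cUF _ Uzz0)) => //.
Qed.

(** For [x] in [F], the power [x ^+ #|F : U|] is in [U], so [A] centralizes it and all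
    [A]-conjugates of [x] solve one equation of [card_root_leq]. It suffices to centralize
    generators of [F] over [U], of which log_2 of the index are enough. *)
Lemma leq_index_self_cent A U F : cyclic U -> U \subset F -> F <| A -> U \subset 'C(A) ->
    'C_A(F) \subset U ->
  exists2 r, 2 ^ r <= #|F : U| & #|A : U| <= (#|F : U| * #|F : U|) ^ r.
Proof.
move=> cycU sUF nsFA cUA sCU; have [sFA nFA] := andP nsFA.
have [X defF leX] := index_gen_exists sUF; exists #|X| => //.
have sXF: X \subset F by rewrite defF sub_gen ?subsetUr.
have sCXU: 'C_A(X) \subset U.
  apply: subset_trans sCU; rewrite subsetI subsetIl /= defF centY subsetI subsetIr andbT.
  by apply: subset_trans (subsetIl _ _) _; rewrite centsC.
apply: leq_trans (_ : #|A : 'C_A(X)| <= _).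
  by apply: dvdn_leq; rewrite ?indexg_gt0 ?indexgS.
apply: leq_index_cent => x Xx; have Fx := subsetP sXF x Xx.
apply: leq_trans (card_root_leq (x ^+ #|F : U|) cycU sUF (subset_trans cUA (centS sFA))).
rewrite subset_leq_card //; apply/subsetP=> _ /imsetP[a Aa ->]; rewrite inE.
rewrite memJ_norm ?Fx ?(subsetP nFA) //= -conjXg; apply/eqP/conjg_fixP/commgP.
suffices Ux: x ^+ #|F : U| \in U by apply: (centP (subsetP cUA _ Ux)).
have nUF: F \subset 'N(U).
  by apply: subset_trans (cent_sub U); rewrite centsC (subset_trans cUA) ?centS.
have nUx := subsetP nUF x Fx; rewrite coset_idr ?groupX // morphX //.
by rewrite -card_quotient // expg_cardG // mem_quotient.
Qed.

Lemma leq_index_cent_cyclic G U : cyclic U -> U <| G -> #|G : 'C_G(U)| <= #|U|.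
Proof.
case/cyclicP=> u defU /andP[_ nUG].
have Uu: u \in U by rewrite defU cycle_id.
rewrite defU cent_cycle index_cent1 -defU subset_leq_card //.
by apply/subsetP=> _ /imsetP[g Gg ->]; rewrite memJ_norm // (subsetP nUG).
Qed.

(* [F] is taken maximal; an abelian chief factor of [G] in ['C_A(F) / U] could be adjoined to it. *)
Lemma self_cent_class2_exists G U : solvable G -> U <| G -> abelian U ->
    (forall V : {group gT}, V <| G -> abelian V -> U \subset V -> U :=: V) ->
  exists F : {group gT}, [/\ U \subset F, F \subset 'C_G(U), F <| G, F^`(1) \subset U &
                             'C_G(F) \subset U].
Proof.
move=> solG nsUG cUU maxU; have [sUG nUG] := andP nsUG.
pose P (F : {group gT}) := [&& U \subset F, F \subset 'C_G(U), F <| G & F^`(1) \subset U].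
have PU : P U.
  by apply/and4P; split; rewrite ?der_sub // subsetI sUG; apply: cUU.
have [F maxF sUF] := maxgroup_exists PU.
have {maxF} [/and4P[_ sFC nsFG dF] maxF] := maxgroupP maxF.
have [sFG nFG] := andP nsFG; have cFU : F \subset 'C(U) by rewrite (subset_trans sFC) ?subsetIr.
exists F; split=> //; set D := 'C_G(F).
have nsDG : D <| G.
  by rewrite /normal subsetIl normsI ?normG // norms_cent.
(* ['Z(F)] is abelian, normal in [G] and contains [U], which is maximal. *)
have ZU : U :=: 'Z(F).
  apply: (maxU ('Z(F))%G); rewrite ?center_abelian ?(char_normal_trans (center_char F)) //.
  by rewrite subsetI sUF centsC.
have DFU : D :&: F \subset U by rewrite ZU /D setIAC (setIidPr sFG).
have sUD : U \subset D by rewrite subsetI sUG centsC.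
apply/idPn=> notDU.
have ntDU : D / U != 1 by rewrite -subG1 quotient_sub1 ?(subset_trans (subsetIl _ _) nUG).
have [E1 minE sE1] : {E1 : {group coset_of U} | minnormal E1 (G / U) & E1 \subset D / U}.
  by apply: minnormal_exists => //; rewrite ?quotient_norms ?normal_norm //.
have [nE1 ntE1 abE1] := minnormal_solvable minE (subset_trans sE1 (quotientS U (normal_sub nsDG))) (quotient_sol U solG).
have cE1 : abelian E1 by case/is_abelemP: abE1 => q _ /abelem_abelian.
have sE1G : E1 \subset G / U := subset_trans sE1 (quotientS U (normal_sub nsDG)).
(* [E1] centralizes [F / U], so adjoining it keeps the quotient abelian. Maximality of [F] then puts
   the preimage of [E1] inside [D :&: F], hence inside [U]. *)
pose F1 := (coset U @*^-1 (E1 <*> (F / U)))%G.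
have nUF := subset_trans sFG nUG.
have nsUC : U <| 'C_G(U).
  by rewrite /normal subsetI sUG (subset_trans (subsetIl _ _) nUG) andbT; apply: cUU.
have sDC : D \subset 'C_G(U) by rewrite subsetI subsetIl (subset_trans (subsetIr _ _)) ?centS.
have nsUD : U <| D by rewrite /normal sUD (subset_trans (subsetIl _ _) nUG).
have nsUF : U <| F by rewrite /normal sUF.
have cF1 : abelian (E1 <*> (F / U)).
  rewrite abelianY cE1 /= sub_der1_abelian //= centsC (subset_trans sE1) //.
  by rewrite quotient_cents ?subsetIr.
have PF1 : P F1.
  apply/and4P; split.
  - exact: sub_cosetpre.
  - by rewrite -(quotientGK nsUC) morphpreS // join_subG (subset_trans sE1) ?quotientS.
  - rewrite -(quotientGK nsUG) cosetpre_normal normalY ?quotient_normal //.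
    by rewrite /normal sE1G.
  apply: der1_min; first exact: subsetIl.
  by rewrite /= cosetpreK.
have sFF1 : F \subset F1 by rewrite -(quotientGK nsUF) morphpreS ?joing_subr.
have DF := maxF _ PF1 sFF1.
have sE1U : coset U @*^-1 E1 \subset U.
  apply: subset_trans DFU; rewrite subsetI; apply/andP; split.
    by have:= morphpreS (coset U) sE1; rewrite (quotientGK nsUD).
  by rewrite -DF morphpreS ?joing_subl.
case/eqP: ntE1; apply/trivgP; rewrite -(cosetpreK E1).
by rewrite -(trivg_quotient U) quotientS.
Qed.
End CentralSeries.

(** * A metabelian subgroup from the Galois action on U *)

Section MetabelianSubgroup.
Variables (p : nat) (gT : finGroupType) (G U : {group gT}) (u : gT).
Hypotheses (p'U : coprime p #|U|) (defU : U :=: <[u]>) (nsUG : U <| G).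
Hypothesis galU : forall g, g \in G -> exists i, u ^ g = u ^+ (p ^ i).

Let a := totient #|U|.

Let powa x k : x \in U -> x ^+ (p ^ (a * k)) = x.
Proof.
move=> Ux; elim: k => [|k IHk]; first by rewrite muln0 expg1.
rewrite mulnS expnD expgM.
suffices ->: x ^+ (p ^ a) = x by [].
have x1 := expg_cardG Ux.
by rewrite -(expg_mod _ x1) Euler_exp_totient // expg_mod.
Qed.

Let pow_inj k x y : x \in U -> y \in U -> x ^+ (p ^ k) = y ^+ (p ^ k) -> x = y.
Proof.
have le_k: k <= a * k by rewrite leq_pmull // totient_gt0 cardG_gt0.
move=> Ux Uy eq_xy; rewrite -(powa k Ux) -(powa k Uy) -(subnKC le_k) expnD !expgM.
by rewrite eq_xy.
Qed.

(* The exponents [i] with [u ^ h = u ^+ (p ^ i)] for some [h \in M] are the multiples of the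
   least positive one. *)
Lemma galois_cyclic_mod_cent (M : {group gT}) : M \subset G ->
  exists2 h0, h0 \in M & forall h, h \in M -> exists k, h0 ^- k * h \in 'C(U).
Proof.
move=> sMG; have Uu: u \in U by rewrite defU cycle_id.
have nUM h : h \in M -> h \in 'N(U) by move/(subsetP sMG)/(subsetP (normal_norm nsUG)).
pose S i := (0 < i) && [exists h in M, u ^ h == u ^+ (p ^ i)].
have exS : exists i, S i.
  exists a; rewrite /S totient_gt0 cardG_gt0; apply/exists_inP; exists 1; first exact: group1.
  by rewrite conjg1 -{1}(powa 1 Uu) muln1.
have [i0 /andP[i0_gt0 /exists_inP[h0 Mh0 /eqP uh0]] min_i0] := ex_minnP exS.
exists h0 => // h Mh; have [i ui] := galU (subsetP sMG h Mh).
pose k := i %/ i0; exists k; pose h' := h0 ^- k * h.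
have Mh' : h' \in M by rewrite groupM ?groupV ?groupX.
have uh0k j : u ^ (h0 ^+ j) = u ^+ (p ^ (i0 * j)).
  elim: j => [|j IHj]; first by rewrite muln0 conjg1.
  by rewrite expgS conjgM uh0 conjXg IHj -expgM -expnD mulnS addnC.
have uh' : u ^ h' = u ^+ (p ^ (i %% i0)).
  apply: (@pow_inj (i0 * k)); rewrite ?groupX ?memJ_norm ?nUM //.
  rewrite -conjXg -uh0k -conjgM /h' mulKVg ui -expgM -expnD.
  by rewrite addnC mulnC -divn_eq.
have r0 : i %% i0 = 0.
  have ltr : i %% i0 < i0 by rewrite ltn_mod.
  apply/eqP; rewrite -leqn0 leqNgt; apply/negP=> r_gt0; move: ltr; rewrite ltnNge => /negP; apply.
  by apply: min_i0; rewrite /S r_gt0; apply/exists_inP; exists h'; rewrite ?uh'.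
rewrite defU cent_cycle; apply/cent1P/esym/commgP/conjg_fixP.
by rewrite uh' r0 expn0 expg1.
Qed.

(** [M / U] is the centralizer of [A / U], whose elements have at most [|A : U|] conjugates each.
    Its part inside [A / U] is central with cyclic quotient, so [M / U] is abelian and the derived
    subgroup of [M] lies in the abelian [U]. *)
Lemma galois_metabelian : exists M : {group gT},
  [/\ M \subset G, #|G : M| <= #|'C_G(U) : U| ^ #|'C_G(U) : U| & M^`(2) = 1].
Proof.
have [sUG nUG] := andP nsUG; pose A := ('C_G(U))%G.
have cUU : abelian U by rewrite defU cycle_abelian.
have nsAG : A <| G by rewrite /normal subsetIl normsI ?normG // norms_cent.
have sAG := normal_sub nsAG; have nUA := subset_trans sAG nUG.
have sUA : U \subset A by rewrite subsetI sUG; apply: cUU.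
pose Q := ('C_(G / U)(A / U))%G; pose M := (coset U @*^-1 Q)%G.
have sQG : Q \subset G / U by apply: subsetIl.
have sMG : M \subset G by rewrite -(quotientGK nsUG) morphpreS.
have MU : M / U = Q by rewrite /= cosetpreK.
have nUM := subset_trans sMG nUG.
have sUM : U \subset M by apply: sub_cosetpre.
exists M; split=> //.
  have ->: #|G : M| = #|G / U : Q| by rewrite -MU index_quotient_eq // (subset_trans (subsetIr _ _)).
  rewrite -(card_quotient nUA); apply: leq_index_cent => x Ax; apply: subset_leq_card.
  apply/subsetP=> _ /imsetP[y Gy ->]; rewrite memJ_norm //.
  by rewrite (subsetP _ y Gy) // quotient_norms ?normal_norm.
have [h0 Mh0 gen] := galois_cyclic_mod_cent sMG.
have cQQ : abelian Q.
  have Qh0 : coset U h0 \in Q by rewrite -MU mem_quotient.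
  have sQ : Q \subset <[coset U h0]> * (Q :&: A / U).
    rewrite -{1}MU; apply/subsetP=> _ /morphimP[h nUh Mh ->].
    have [k cUh] := gen h Mh; set b := _ * h in cUh.
    have Mb : b \in M by rewrite groupM ?groupV ?groupX.
    have ->: h = h0 ^+ k * b by rewrite mulKVg.
    rewrite morphM ?groupX ?(subsetP nUM) //= morphX ?(subsetP nUM) //.
    rewrite mem_mulg ?mem_cycle // inE -{1}MU !mem_quotient //.
    by rewrite inE (subsetP sMG).
  have cQA : A / U \subset 'C(Q) by rewrite centsC subsetIr.
  have cAA : abelian (<[coset U h0]> <*> (Q :&: A / U)).
    rewrite abelianY cycle_abelian /=; apply/andP; split.
      by apply: subset_trans (subsetIr _ _) (subset_trans cQA (centS (subsetIl _ _))).
    apply: subset_trans (subsetIr _ _) (subset_trans cQA (centS _)).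
    by rewrite cycle_subG.
  apply: abelianS cAA; apply: subset_trans sQ _.
  by rewrite -gen_subG genM_join joingE.
have sM'U : M^`(1) \subset U by rewrite der1_min // MU.
by apply/trivgP; rewrite (subset_trans (dergS 1 sM'U)) // (derG1P cUU).
Qed.
End MetabelianSubgroup.

(** [b] bounds [|A : U|] by [few_orbits_bound], and [b ^ b] the index of the centralizer of
    [A / U]. *)
Definition prim_bound m := (let b := 2 ^ (2 * (m + 25) ^ 2) in b ^ b)%N.

Section Primitive.
Variables (p : nat) (gT : finGroupType) (G : {group gT}) (n' : nat).
Variable rG : mx_representation 'F_p G n'.+1.
Hypotheses (p_pr : prime p) (irrG : mx_irreducible rG) (ffulG : mx_faithful rG).

(** A simple [U]-submodule is already faithful: were [x <> 1] trivial on it, the invertible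
    [rG x - rG 1] would kill it. An abelian group with a faithful irreducible module is cyclic. *)
Lemma Uenv_field_cyclic (U : {group gT}) (nsUG : U <| G) :
  abelian U -> Uenv_field rG nsUG -> cyclic U.
Proof.
move=> cUU fieldU; pose rU := subg_repr rG (normal_sub nsUG).
have nz1 : (1%:M : 'M['F_p]_n'.+1)%R != 0%R by apply: oner_neq0.
apply: (mxsimple_exists (mxmodule1 rU) nz1) => [[S simS _]].
have modS := mxsimple_module simS.
have irrS : mx_irreducible (submod_repr modS) by apply/submod_mx_irr.
apply: (mx_faithful_irr_abelian_cyclic _ irrS cUU).
apply/subsetP=> x; rewrite rker_submod !inE => /andP[Ux /eqP Sx].
apply: contraTT (nz_row_mxsimple simS) => ne_x1; rewrite negbK.
have [B _ unitB] := rG_inj_unit p_pr irrG ffulG cUU fieldU Ux (group1 U) ne_x1.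
have Sx0 : (S *m (rG x - rG 1%g) = 0)%R by rewrite mulmxBr repr_mx1 mulmx1 [(S *m _)%R]Sx subrr.
rewrite nz_row_eq0 -[S]mulmx1 -[(1%:M)%R]unitB -[((_ - _) * B)%R]/((_ - _) *m B)%R.
by rewrite mulmxA Sx0 mul0mx.
Qed.

Lemma metab_index_primitive m : solvable G -> norb rG <= m ->
    (forall (U : {group gT}) (nsUG : U <| G), abelian U -> Uenv_field rG nsUG) ->
  metab_index p (prim_bound m) rG.
Proof.
move=> solG norbG fieldG.
pose P (U : {group gT}) := (U <| G) && abelian U.
have [|U maxU _] := @maxgroup_exists _ P 1%G; first by rewrite /P normal1 abelian1.
have {maxU} [/andP[nsUG cUU] maxU] := maxgroupP maxU.
have fieldU := fieldG U nsUG cUU; have [sUG nUG] := andP nsUG.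
have cycU := Uenv_field_cyclic cUU fieldU.
have [u defU] := cyclicP cycU.
have [|F [sUF sFC nsFG dF sCFU]] := self_cent_class2_exists solG nsUG cUU.
  by move=> V nsVG cVV sUV; rewrite (maxU V) // /P nsVG.
have sFG := normal_sub nsFG.
have p'U := Uenv_p'group p_pr irrG ffulG nsUG cUU.
have coU : coprime p #|U| by rewrite prime_coprime // -p'natE.
have [M [sMG leM M2]] := galois_metabelian coU defU nsUG
  (fun g Gg => Uenv_galois p_pr irrG ffulG cUU fieldU defU Gg).
exists M; split=> //; last first.
  by move=> x; rewrite M2 => /set1P-> _; apply: repr_mx1.
have cFU : U \subset 'C(F) by rewrite centsC (subset_trans sFC) ?subsetIr.
have sZFU : 'C_F(F) \subset U by rewrite (subset_trans _ sCFU) ?setSI.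
have [d [leV leN]] := leq_Uenv_dim p_pr irrG ffulG cUU fieldU sUF sFG cFU dF sZFU.
have nsFA : F <| 'C_G(U) := normalS sFC (subsetIl _ _) nsFG.
have [||r le_r leA] := leq_index_self_cent cycU sUF nsFA.
- by rewrite centsC subsetIr.
- by rewrite (subset_trans _ sCFU) // setSI ?subsetIl.
have leG := leq_index_cent_cyclic cycU nsUG.
have sUA : U \subset 'C_G(U) by rewrite subsetI sUG; apply: cUU.
have bound : (#|F : U| * #|F : U|) ^ r <= 2 ^ (2 * (m + 25) ^ 2).
  apply: few_orbits_bound leV leN _ le_r; first by rewrite ltnS cardG_gt0.
  apply: leq_trans (leq_card_norb rG) _; rewrite leq_mul //.
  rewrite -(Lagrange (subsetIl G 'C(U))) -(Lagrange sUA) mulnAC.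
  by rewrite leq_mul // leq_mul // ltnW.
apply: leq_trans leM _; rewrite /prim_bound.
have le_b := leq_trans leA bound; set b := (2 ^ _)%N in le_b *.
apply: leq_trans (_ : b ^ #|'C_G(U) : U| <= _).
  by rewrite leq_exp2r ?indexg_gt0.
by rewrite leq_pexp2l // expn_gt0.
Qed.
End Primitive.

(** * Induction on the number of orbits *)

Lemma metab_index_leq p c c' (F : fieldType) (gT : finGroupType) (G : {group gT}) n
    (rG : mx_representation F G n) :
  c <= c' -> metab_index p c rG -> metab_index p c' rG.
Proof.
by move=> lecc [M [sMG leM M2]]; exists M; split=> //; apply: leq_trans lecc.
Qed.

Section Reduction.
Variables (p : nat) (gT : finGroupType) (G : {group gT}) (n : nat).
Variable rG : mx_representation 'F_p G n.
Hypothesis p_pr : prime p.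

Section Submodule.
Variable V : 'M['F_p]_n.
Hypothesis modV : mxmodule rG V.

Lemma norb_submod : ~~ row_full V -> norb (submod_repr modV) < norb rG.
Proof.
move=> nfullV; have [v notVv]: exists v : 'rV['F_p]_n, ~~ (v <= V)%MS.
  have /row_subPn[i] : ~~ ((1%:M)%R <= V)%MS by rewrite sub1mx.
  by exists (row i 1%:M)%R.
apply: (@norb_ltn _ _ _ _ _ _ _ rG _ (@val_submod _ _ V 1) _ v).
  by move=> x y g Gg; rewrite -(val_submodJ modV) // => /val_submod_inj ->; exists g.
move=> x g Gg Dv; case/negP: notVv; rewrite Dv (mxmodule_trans modV) //.
exact: val_submodP.
Qed.

Lemma norb_factmod : V != 0%R -> norb (factmod_repr modV) < norb rG.
Proof.
move=> nzV; apply: (@norb_ltn _ _ _ _ _ _ _ rG _ (@val_factmod _ _ V 1) _ (nz_row V)).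
  move=> x y g Gg /(congr1 (in_factmod V)); rewrite (in_factmodJ modV) // !val_factmodK.
  by exists g.
move=> x g Gg Dv; move: nzV; rewrite -nz_row_eq0 => /eqP; apply.
have := congr1 (in_factmod V) Dv; rewrite (in_factmodJ modV) // val_factmodK.
have /eqP-> : in_factmod V (nz_row V) == 0%R by rewrite in_factmod_eq0 nz_row_sub.
move/(canLR (repr_mxK (factmod_repr modV) Gg)); rewrite mul0mx => x0.
by rewrite Dv -x0 /val_factmod linear0 mul0mx.
Qed.

(** A [p']-element [x] trivial on both factors acts as [1 + N] with [N] of square 0, so [x ^+ k]
    acts as [1 + k N]; for [k] the order of [x], prime to [p], this gives [N = 0]. *)
Lemma metab_index_extension c1 c2 : metab_index p c1 (submod_repr modV) ->
  metab_index p c2 (factmod_repr modV) -> metab_index p (c1 * c2) rG.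
Proof.
move=> [M1 [sM1 le1 c1M]] [M2 [sM2 le2 c2M]]; exists (M1 :&: M2)%G; split.
- by apply: subset_trans sM1; apply: subsetIl.
- by apply: leq_trans (leq_index_capI _ _ _) _; rewrite leq_mul.
move=> x M12x p'x; have M1x := subsetP (dergS 2 (subsetIl M1 M2)) x M12x.
have M2x := subsetP (dergS 2 (subsetIr M1 M2)) x M12x.
have Gx : x \in G by rewrite (subsetP sM1) // (subsetP (der_sub 2 M1)).
pose N := (rG x - 1%:M)%R.
have VN : (V *m N = 0)%R.
  have := val_submodJ modV (1%:M)%R Gx; rewrite [submod_mx _ x](c1M x) // mulmx1 => Dv.
  have /submxP[D De] : (V <= val_submod (U := V) 1%:M)%MS by rewrite val_submod1.
  by rewrite /N mulmxBr mulmx1 {1}De -mulmxA -[(val_submod _ *m _)%R]Dv -De subrr.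
have NV : (N <= V)%MS.
  rewrite -in_factmod_eq0 /N linearB /= subr_eq0.
  have := in_factmodJ modV (1%:M)%R Gx; rewrite [factmod_mx _ x](c2M x) // mulmx1 mul1mx.
  by move=> ->.
have NN : (N *m N = 0)%R by have /submxP[D DN] := NV; rewrite {1}DN -mulmxA VN mulmx0.
have powN k : rG (x ^+ k) = (1%:M + k%:R *: N)%R.
  elim: k => [|k IHk]; first by rewrite repr_mx1 scale0r addr0.
  rewrite expgSr repr_mxM ?groupX // IHk (_ : rG x = 1%:M + N)%R; last by rewrite addrC subrK.
  rewrite mulmxDl mul1mx mulmxDr mulmx1 -scalemxAl NN scaler0 addr0.
  by rewrite -addrA -natr1 scalerDl scale1r [(N + _)%R]addrC.
have : N = 0%R.
  have := powN #[x]; rewrite expg_order repr_mx1 => /eqP.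
  rewrite -[X in X == _]addr0 (inj_eq (addrI _)) eq_sym scaler_eq0 => /orP[|/eqP //].
  rewrite -(dvdn_pcharf (pchar_Fp p_pr)) => p_x.
  by move: p'x; rewrite /p_elt p'natE // p_x.
by move/eqP; rewrite subr_eq0 => /eqP.
Qed.
End Submodule.

Lemma norb_kquo : norb (kquo_repr rG) <= norb rG.
Proof.
apply: (@norb_leq _ _ _ _ _ _ _ rG (kquo_repr rG) id) => x y g Gg ->.
by exists (coset (rker rG) g); rewrite ?mem_quotient // kquo_repr_coset.
Qed.

Lemma metab_index_kquo c : metab_index p c (kquo_repr rG) -> metab_index p c rG.
Proof.
have nsKG := rker_normal rG; have nKG := normal_norm nsKG.
case=> M [sMG leM cM]; exists (coset (rker rG) @*^-1 M)%G.
have sMG' : coset (rker rG) @*^-1 M \subset G by rewrite -(quotientGK nsKG) morphpreS.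
split=> //.
  rewrite -(index_quotient_eq (H := [group of rker rG])) //=; first by rewrite cosetpreK.
  by rewrite (subset_trans (subsetIr _ _)) ?sub_cosetpre.
move=> x M2x p'x; have Gx : x \in G by rewrite (subsetP sMG') // (subsetP (der_sub 2 _)).
rewrite -(kquo_repr_coset rG Gx); apply: cM; last exact: morph_p_elt (subsetP nKG x Gx) p'x.
have := mem_quotient (rker rG) M2x.
by rewrite quotient_der ?(subset_trans sMG') //= cosetpreK.
Qed.
End Reduction.

Lemma metab_index_faithful_irr p m c (gT : finGroupType) (G : {group gT}) n'
    (rG : mx_representation 'F_p G n'.+1) :
    prime p -> mx_irreducible rG -> mx_faithful rG -> solvable G -> norb rG <= m ->
    (forall (hT : finGroupType) (H : {group hT}) k (rH : mx_representation 'F_p H k),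
      solvable H -> norb rH < norb rG -> metab_index p c rH) ->
  metab_index p (maxn (prim_bound m) ((m * c) ^ m)) rG.
Proof.
move=> p_pr irrG ffulG solG norbG IH.
have [fieldG | notfield] := classic
    (forall (U : {group gT}) (nsUG : U <| G), abelian U -> Uenv_field rG nsUG).
  by apply: metab_index_leq (leq_maxl _ _) _; apply: metab_index_primitive.
have {notfield} [U [nsUG [cUU notfield]]] : exists U : {group gT}, exists nsUG : U <| G,
    abelian U /\ ~ Uenv_field rG nsUG.
  apply: NNPP => noU; apply: notfield => U nsUG cUU; apply: NNPP => notfield.
  by apply: noU; exists U, nsUG.
have {notfield} [e [Ee [ee [nze ne1]]]] : exists e, e \in Uenv rG nsUG /\
    ((e * e = e)%R /\ (e != 0%R /\ e != 1%R)).
  apply: NNPP => noe; apply: notfield => ? e Ee ee.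
  have [-> | nze] := eqVneq e 0%R; first by left.
  have [-> | ne1] := eqVneq e 1%R; first by right.
  by case: noe; exists e.
apply: metab_index_leq (leq_maxr _ _) _.
have idI : {in prim_idem rG nsUG, forall e, (e * e = e)%R /\ e != 0%R}.
  by move=> f /prim_idemP[].
have orthI : {in prim_idem rG nsUG &, forall e f, e != f -> (e * f = 0)%R}.
  exact: prim_idem_orth.
have sumI : (\sum_(e in prim_idem rG nsUG) e = 1)%R by apply: prim_idem_sum.
have conjI g f : g \in G -> f \in prim_idem rG nsUG ->
    (rG (g^-1)%g * f * rG g)%R \in prim_idem rG nsUG.
  exact: prim_idem_conj.
have I_gt1 := card_prim_idem cUU Ee ee nze ne1.
apply: (metab_index_blocks idI orthI sumI conjI I_gt1 norbG) => f If.
apply: IH; first exact: solvableS (rcent_sub rG f) solG.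
exact: (block_norb idI orthI conjI I_gt1 If).
Qed.

(** The terms of the maximum serve, in turn, the module of dimension 0, a proper nonzero submodule
    with its quotient, and the two cases of an irreducible module. At 0 there is nothing to bound,
    since the zero vector always gives an orbit. *)
Fixpoint metab_bound m :=
  if m is m'.+1 then
    let c := metab_bound m' in
    maxn (maxn 1 (c * c)) (maxn (prim_bound m) ((m * c) ^ m))%N
  else 0.

Lemma metab_index_norb p m (gT : finGroupType) (G : {group gT}) n
    (rG : mx_representation 'F_p G n) :
  prime p -> solvable G -> norb rG <= m -> metab_index p (metab_bound m) rG.
Proof.
move=> p_pr; elim: m gT G n rG => [|m IHm] gT G n rG solG norbG.
  move: norbG; rewrite leqn0 => /eqP norb0.
  have : #|{: unit}| <= norb rG by apply: (@leq_norb _ _ _ _ rG _ (fun=> 0%R)) => [[] []].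
  by rewrite card_unit norb0.
rewrite /=; set c := metab_bound m in IHm *.
have IH (hT : finGroupType) (H : {group hT}) k (rH : mx_representation 'F_p H k) :
    solvable H -> norb rH < norb rG -> metab_index p c rH.
  by move=> solH lt_norb; apply: IHm => //; rewrite -ltnS (leq_trans lt_norb).
case: n => [|n] in rG norbG IH *.
  apply: metab_index_leq (leq_trans (leq_maxl _ _) (leq_maxl _ _)) _.
  by exists G; split; rewrite ?indexgg // => x _ _; rewrite [rG x]flatmx0 flatmx0.
have [irrG | redG] := classic (mx_irreducible rG).
  (* Dividing by the kernel makes the module faithful without adding orbits. *)
  apply: metab_index_leq (leq_maxr _ _) _; apply: metab_index_kquo.
  apply: (metab_index_faithful_irr p_pr).
  - exact/quo_mx_irr.
  - exact: kquo_mx_faithful.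
  - exact: quotient_sol.
  - exact: leq_trans (norb_kquo rG) norbG.
  by move=> hT H k rH solH ltH; apply: IH => //; apply: leq_trans ltH (norb_kquo rG).
have [V /and4P[modV _ nzV ltV]] : mxnonsimple rG 1%:M%R.
  apply: NNPP => simV; case: redG; apply/mxsimpleP; split=> //; first exact: mxmodule1.
  exact: oner_neq0.
apply: metab_index_leq (leq_trans (leq_maxr 1 _) (leq_maxl _ _)) _.
apply: (metab_index_extension p_pr (modV := modV)); apply: IH => //.
  by apply: norb_submod; move: ltV; rewrite mxrank1 /row_full ltn_neqAle => /andP[].
exact: norb_factmod.
Qed.

(** * The Frattini quotient of the Fitting subgroup *)

(** Climb the derived series of [C]: if the derived subgroup of a term is in ['F(G)], which [C]
    centralizes, it is central in that term, so the term is nilpotent, normal in [G] and inside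
    ['F(G)]. *)
Lemma solvable_cent_Fitting (gT : finGroupType) (G : {group gT}) :
  solvable G -> 'C_G('F(G)) \subset 'F(G).
Proof.
move=> solG; set C := 'C_G('F(G)).
have nsFG := Fitting_normal G.
have nsCG : C <| G by rewrite /normal subsetIl normsI ?normG // norms_cent ?normal_norm.
have [n Cn1] := derivedP _ (solvableS (normal_sub nsCG) solG).
suffices derF k : k <= n -> C^`(n - k) \subset 'F(G).
  by have := derF n (leqnn n); rewrite subnn.
elim: k => [|k IHk] lekn.
  by rewrite subn0 [C^`(n)]Cn1 sub1G.
have {IHk} := IHk (ltnW lekn); rewrite (_ : n - k = (n - k.+1).+1); last by rewrite subnSK.
set H := (C^`(n - k.+1))%G => sH'F.
have nsHG : H <| G := char_normal_trans (der_char _ _) nsCG.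
apply: Fitting_max => //; rewrite -quotient_center_nil; apply/abelian_nil/sub_der1_abelian.
rewrite subsetI der_sub centsC (subset_trans (der_sub _ _ : H \subset C)) //.
by rewrite (subset_trans (subsetIr _ _)) // centS.
Qed.

(** By coprime action the centralizer of [x] in [P] covers [P / 'Phi(P)]; as ['Phi(P)] consists of
    nongenerators, it is all of [P]. *)
Lemma coprime_cent_quotient_Phi (gT : finGroupType) (p : nat) (P : {group gT}) x :
    p.-group P -> p^'.-elt x -> x \in 'N(P) -> coset 'Phi(P) x \in 'C(P / 'Phi(P)) ->
  x \in 'C(P).
Proof.
move=> pP p'x nPx cPx; rewrite -cycle_subG centsC.
have nPX : <[x]> \subset 'N(P) by rewrite cycle_subG.
have nPhiX : <[x]> \subset 'N('Phi(P)) := char_norm_trans (Phi_char P) nPX.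
have pPhi : p.-group 'Phi(P) := pgroupS (Phi_sub P) pP.
have co : coprime #|'Phi(P)| #|<[x]>| by rewrite (pnat_coprime pPhi).
have := coprime_norm_quotient_cent nPX nPhiX co (pgroup_sol pPhi).
have -> : 'C_(P / 'Phi(P))(<[x]> / 'Phi(P)) = P / 'Phi(P).
  apply/setIidPl; rewrite centsC quotient_cycle ?cycle_subG //.
  by rewrite -cycle_subG.
move=> defC; have defP : 'Phi(P) <*> 'C_P(<[x]>) = P.
  apply/eqP; rewrite eqEsubset join_subG Phi_sub subsetIl /=.
  have nPhiP := normal_norm (Phi_normal P).
  rewrite norm_joinEr ?(subset_trans (subsetIl _ _)) // -quotientSK ?nPhiP //.
  by rewrite defC.
have := Phi_nongen defP; rewrite genGid => <-; exact: subsetIr.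
Qed.

Section FrattiniQuotient.
Variables (p : nat) (gT : finGroupType) (G P : {group gT}).
Hypotheses (p_pr : prime p) (nsPG : P <| G) (pP : p.-group P) (ntP : P :!=: 1).

Let Phi := 'Phi(P).

Let nsPhiG : Phi <| G := char_normal_trans (Phi_char P) nsPG.

Let abelE : p.-abelem (P / Phi)%G := Phi_quotient_abelem pP.

Let ntE : (P / Phi)%G :!=: 1.
Proof.
rewrite -subG1 quotient_sub1 ?normal_norm ?Phi_normal //.
by case/andP: (Phi_proper ntP).
Qed.

Let nEG : (G / Phi)%G \subset 'N((P / Phi)%G).
Proof. by rewrite quotient_norms ?normal_norm. Qed.

Local Notation rG := (abelem_repr abelE ntE nEG).

(** Lift each vector to an element of [P], which is a [p]-element; vectors with conjugate lifts lie
    in one orbit. *)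
Lemma norb_Frattini : norb rG <= #|p_elt_classes p G|.
Proof.
pose x (v : 'rV['F_p]_('dim (P / Phi)%G)) := repr (rVabelem abelE ntE v).
have nPx v : x v \in 'N(Phi) by apply: repr_coset_norm.
have xK v : coset Phi (x v) = rVabelem abelE ntE v by apply: coset_reprK.
have Px v : x v \in P.
  rewrite -(quotientGK (Phi_normal P)) mem_morphpre //= xK; exact: mem_rVabelem.
apply: leq_trans (leq_card_imset_factor (g := fun v => x v ^: G) _) _.
  move=> v w _ _ eq_vw; have : x w \in x v ^: G by rewrite eq_vw class_refl.
  case/imsetP=> g Gg Dxw; apply/eqP/orbit_reprP; exists (coset Phi g); first exact: mem_quotient.
  apply: (@rVabelem_inj _ _ _ abelE ntE); rewrite rVabelemJ ?mem_quotient // -!xK Dxw.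
  by rewrite morphJ // (subsetP (normal_norm nsPhiG)).
rewrite subset_leq_card //; apply/subsetP=> _ /imsetP[v _ ->].
rewrite inE mem_classes ?(subsetP (normal_sub nsPG)) //=.
apply/subsetP=> _ /imsetP[g Gg ->]; rewrite inE.
by rewrite (mem_p_elt pP) // memJ_norm // (subsetP (normal_norm nsPG)).
Qed.

Lemma der2_p'elt_cent : solvable G -> exists M : {group gT},
  [/\ M \subset G, #|G : M| <= metab_bound #|p_elt_classes p G| &
      forall x, x \in M^`(2) -> p^'.-elt x -> x \in 'C(P)].
Proof.
move=> solG; have nPhiG := normal_norm nsPhiG.
have [M [sMG leM cM]] := metab_index_norb p_pr (quotient_sol Phi solG) norb_Frattini.
exists (coset Phi @*^-1 M)%G.
have sMG' : coset Phi @*^-1 M \subset G by rewrite -(quotientGK nsPhiG) morphpreS.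
split=> //.
  rewrite -(index_quotient_eq (H := [group of Phi])) //=; first by rewrite cosetpreK.
  by rewrite (subset_trans (subsetIr _ _)) ?sub_cosetpre.
move=> x M2x p'x; have Gx : x \in G by rewrite (subsetP sMG') // (subsetP (der_sub 2 _)).
apply: (coprime_cent_quotient_Phi pP p'x); first by rewrite (subsetP (normal_norm nsPG)).
have xM : coset Phi x \in M^`(2).
  have := mem_quotient Phi M2x.
  by rewrite quotient_der ?(subset_trans sMG') //= cosetpreK.
have : coset Phi x \in rker rG.
  by apply/rkerP; split; rewrite ?mem_quotient // cM // morph_p_elt ?(subsetP nPhiG).
by rewrite rker_abelem => /setIP[].
Qed.
End FrattiniQuotient.

(** * The normal subgroup of bounded index *)

Unset Implicit Arguments.

Theorem theorem7p1 (p : nat) (p_pr : prime p) :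
  exists f : nat -> R,
    forall (gT : finGroupType) (G : {group gT}),
      solvable G -> 'O_p^'(G) = 1 ->
      exists N : {group gT},
        [/\ N <| G, 'F(G) \subset N, metabelian (N / 'F(G))
          & Rle (INR #|G / N|) (f #|p_elt_classes p G|)].
Proof.
(* The power accounts for replacing a subgroup by its core; the maximum with 1 covers the trivial
   group. *)
exists (fun m => INR (maxn 1 (metab_bound m ^ metab_bound m)%N)) => gT G solG Op'1.
set m := #|_|; have defF := Fitting_eq_pcore Op'1.
have [F1 | ntF] := eqVneq 'F(G) 1.
  have G1 : G :=: 1 by apply/eqP; rewrite -trivg_Fitting // F1.
  exists G; split; rewrite ?Fitting_sub ?normal_refl // /metabelian.
    by rewrite G1 quotient1 (derG1P (abelian1 _)) abelian1.
  by rewrite trivg_quotient cards1; apply/le_INR/leP; rewrite leq_maxl.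
have pF : p.-group 'F(G) by rewrite defF pcore_pgroup.
have [M [sMG leM cM]] := der2_p'elt_cent p_pr (Fitting_normal G) pF ntF solG.
have sCF := solvable_cent_Fitting solG.
(* An element of prime order other than [p] here would centralize ['F(G)], hence lie in this
   [p]-group. *)
have pM2 : p.-group M^`(2).
  apply/pgroupP=> q q_pr /(Cauchy q_pr)[x M2x ox]; rewrite inE /=.
  apply/idPn=> ne_qp; have p'x : p^'.-elt x by rewrite /p_elt ox pnatE.
  have Gx : x \in G by rewrite (subsetP sMG) // (subsetP (der_sub 2 M)).
  have Fx : x \in 'F(G) by apply: (subsetP sCF); rewrite inE Gx cM.
  have px : p.-elt x := mem_p_elt pF Fx.
  by move: px; rewrite /p_elt ox pnatE // inE /= (negPf ne_qp).
(* The second derived subgroup of the core is a normal [p]-subgroup of [G], so it lies in ['O_p(G)],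
   which is ['F(G)]. *)
pose K := (gcore M G)%G; have sKM : K \subset M := gcore_sub M G.
have nsKG : K <| G := gcore_normal sMG.
have K2F : K^`(2) \subset 'F(G).
  rewrite defF pcore_max ?(pgroupS (dergS 2 sKM)) //.
  exact: char_normal_trans (der_char 2 K) nsKG.
have nFG := normal_norm (Fitting_normal G).
exists (K <*> 'F(G))%G; split.
- by rewrite normalY ?Fitting_normal.
- exact: joing_subr.
- have nFK : K \subset 'N('F(G)) := subset_trans (normal_sub nsKG) nFG.
  rewrite /metabelian /= quotientYidr // -quotient_der //.
  by apply/derG1P; rewrite -quotient_der ?(subset_trans (der_sub 1 K)) // quotientS1.
have sKN : K \subset (K <*> 'F(G))%G := joing_subl _ _.
have nsNG : (K <*> 'F(G))%G <| G by rewrite normalY ?Fitting_normal.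
apply/le_INR/leP; rewrite card_quotient ?normal_norm // leq_max; apply/orP; right.
apply: leq_trans (dvdn_leq (indexg_gt0 _ _) (indexgS G sKN)) _.
apply: leq_trans (leq_index_gcore G M) _.
apply: leq_trans (_ : metab_bound m ^ #|G : M| <= _); first by rewrite leq_exp2r ?indexg_gt0.
by rewrite leq_pexp2l // (leq_trans (indexg_gt0 G M)).
Qed.
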